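(* There exists a dense $G_\delta$ subset $G$ of $\mathrm{Homeo}(\mathbb{T}^2,\mathrm{Leb})$ such that for every $f\in G$, every lift $F:\mathbb{R}^2\to\mathbb{R}^2$ of $f$ and every nonempty compact subset $K$ of the rotation set $\rho(F)$, there exists a subsequence $(f_{N_i})_i$ of the sequence of discretizations of $f$ such that $\rho(F_{N_i})$ tends to $K$ in the Hausdorff topology as $i\to+\infty$. In particular $\rho^{discr}(F)=\rho(F)$.
   Context: $\mathbb{T}^2=\mathbb{R}^2/\mathbb{Z}^2$, and $\mathrm{Leb}$ is Lebesgue measure. $\mathrm{Homeo}(\mathbb{T}^2,\mathrm{Leb})$ is the set of homeomorphisms of $\mathbb{T}^2$ homotopic to the identity and preserving Lebesgue measure, with the metric of uniform convergence. For such $f$ with lift $F:\mathbb{R}^2\to\mathbb{R}^2$, the rotation set is $\rho(F)=\bigcap_{M\in\mathbb{N}}\overline{\bigcup_{m\ge M}\left\{\frac{F^m(\tilde x)-\tilde x}{m}\mid \tilde x\in\mathbb{R}^2\right\}}$. Discretizations: for $N\ge1$, $E_N=\{(i/2^N,j/2^N)\mid 0\le i,j\le 2^N-1\}\subset\mathbb{T}^2$; $P_N:\mathbb{T}^2\to E_N$ maps $x$ to (a fixed choice of) one of the points of $E_N$ nearest to $x$; $f_N=P_N\circ f:E_N\to E_N$. Applying the same process to $F$ (projecting to a nearest point of $(2^{-N}\mathbb{Z})^2$, with the choices compatible with $P_N$ and integer translations) gives a lift $F_N:(2^{-N}\mathbb{Z})^2\to(2^{-N}\mathbb{Z})^2$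 of $f_N$. The rotation vector of a periodic point $x_N$ of $f_N$ of period $p$ is $\frac{F_N^p(\tilde x_N)-\tilde x_N}{p}$, where $\tilde x_N$ is a lift of $x_N$. The discretized rotation set $\rho(F_N)$ is the (finite) set of rotation vectors of all periodic points of $f_N$. The asymptotic discretized rotation set is the upper limit $\rho^{discr}(F)=\bigcap_{M\in\mathbb{N}}\overline{\bigcup_{N\ge M}\rho(F_N)}$. *)

(* Defs.v *)
(* MathComp-Analysis, over an arbitrary [R : realType]. *)
From HB Require Import structures.
From mathcomp Require Import all_boot all_order all_algebra generic_quotient.
From mathcomp Require Import all_classical all_reals all_analysis.
From mathcomp Require Import borel_hierarchy.
From mathcomp Require Import ring lra.

Set Implicit Arguments.
Unset Strict Implicit.
Unset Printing Implicit Defensive.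

Import Order.TTheory GRing.Theory Num.Theory numFieldNormedType.Exports.

Local Open Scope classical_set_scope.
Local Open Scope ring_scope.
Local Open Scope quotient_scope.

Notation plane R := (R * R)%type.

Section euclid.
Context {R : realType}.
Implicit Types u v w k : plane R.

(* The library norm on [R * R] is the sup norm; distances between points of
   the plane are measured with the Euclidean one. *)
Definition edist u v : R :=
  Num.sqrt ((u.1 - v.1) ^+ 2 + (u.2 - v.2) ^+ 2).

Lemma plane_eq u v : u.1 = v.1 -> u.2 = v.2 -> u = v.
Proof. by case: u v => [? ?] [? ?] /= -> ->. Qed.

Lemma edist_ge0 u v : 0 <= edist u v. Proof. exact: sqrtr_ge0. Qed.

Lemma edistxx u : edist u u = 0.
Proof. by rewrite /edist !subrr expr0n addr0 sqrtr0. Qed.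

Lemma edistC u v : edist u v = edist v u.
Proof. by rewrite /edist; congr Num.sqrt; ring. Qed.

Lemma edistD2r k u v : edist (u + k) (v + k) = edist u v.
Proof. by rewrite /edist /=; congr Num.sqrt; ring. Qed.

Lemma edist_triangle v u w : edist u w <= edist u v + edist v w.
Proof.
rewrite /edist.
set a := u.1 - v.1; set b := u.2 - v.2; set c := v.1 - w.1; set d := v.2 - w.2.
have -> : u.1 - w.1 = a + c by rewrite /a /c; ring.
have -> : u.2 - w.2 = b + d by rewrite /b /d; ring.
have ab0 : 0 <= a ^+ 2 + b ^+ 2 by rewrite addr_ge0 ?sqr_ge0.
have cd0 : 0 <= c ^+ 2 + d ^+ 2 by rewrite addr_ge0 ?sqr_ge0.
set p := Num.sqrt (a ^+ 2 + b ^+ 2); set q := Num.sqrt (c ^+ 2 + d ^+ 2).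
have p0 : 0 <= p by exact: sqrtr_ge0.
have q0 : 0 <= q by exact: sqrtr_ge0.
have p2 : p ^+ 2 = a ^+ 2 + b ^+ 2 by rewrite sqr_sqrtr.
have q2 : q ^+ 2 = c ^+ 2 + d ^+ 2 by rewrite sqr_sqrtr.
have cs : a * c + b * d <= p * q.
  rewrite (le_trans (ler_norm _))// -ler_sqr ?nnegrE ?mulr_ge0//.
  rewrite real_normK ?num_real// exprMn p2 q2 -subr_ge0.
  have -> : (a ^+ 2 + b ^+ 2) * (c ^+ 2 + d ^+ 2) - (a * c + b * d) ^+ 2 =
            (a * d - b * c) ^+ 2 by ring.
  exact: sqr_ge0.
rewrite -(ger0_norm (addr_ge0 p0 q0)) -sqrtr_sqr ler_wsqrtr//.
have -> : (p + q) ^+ 2 = p ^+ 2 + q ^+ 2 + 2 * (p * q) by ring.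
rewrite p2 q2 -subr_ge0.
have -> : a ^+ 2 + b ^+ 2 + (c ^+ 2 + d ^+ 2) + 2 * (p * q) -
   ((a + c) ^+ 2 + (b + d) ^+ 2) = 2 * (p * q - (a * c + b * d)) by ring.
by rewrite mulr_ge0// subr_ge0.
Qed.

Lemma edist_fst u v : `|u.1 - v.1| <= edist u v.
Proof. by rewrite -sqrtr_sqr ler_wsqrtr// lerDl sqr_ge0. Qed.

Lemma edist_snd u v : `|u.2 - v.2| <= edist u v.
Proof. by rewrite -sqrtr_sqr ler_wsqrtr// lerDr sqr_ge0. Qed.

Lemma edist0_eq u v : edist u v = 0 -> u = v.
Proof.
move=> uv0; apply: plane_eq; apply/eqP; rewrite -subr_eq0 -normr_le0 -uv0.
- exact: edist_fst.
- exact: edist_snd.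
Qed.

Lemma edist_le u v : edist u v <= `|u.1 - v.1| + `|u.2 - v.2|.
Proof.
rewrite -[leRHS](ger0_norm (addr_ge0 (normr_ge0 (u.1 - v.1))
  (normr_ge0 (u.2 - v.2)))).
rewrite -[leRHS]sqrtr_sqr ler_wsqrtr// [leRHS]sqrrD !real_normK ?num_real//.
by rewrite addrAC lerDl mulrn_wge0 ?mulr_ge0.
Qed.

End euclid.

Section torus.
Context {R : realType}.
Implicit Types u v w k : plane R.

Definition integral_vec k := (k.1 \is a Num.int) && (k.2 \is a Num.int).

Lemma integral_vecN k : integral_vec (- k) = integral_vec k.
Proof. by rewrite /integral_vec /= !rpredN. Qed.

Lemma integral_vecD k l :
  integral_vec k -> integral_vec l -> integral_vec (k + l).
Proof. by move=> /andP[? ?] /andP[? ?]; rewrite /integral_vec /= !rpredD. Qed.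

Let torus_rel' u v := integral_vec (u - v).

Local Lemma torus_rel_refl : reflexive torus_rel'.
Proof. by move=> u; rewrite /torus_rel' subrr /integral_vec /= !rpred0. Qed.

Local Lemma torus_rel_sym : symmetric torus_rel'.
Proof. by move=> u v; rewrite /torus_rel' -integral_vecN opprB. Qed.

Local Lemma torus_rel_trans : transitive torus_rel'.
Proof.
by move=> v u w uv vw; have := integral_vecD uv vw; rewrite addrA subrK.
Qed.

Definition torus_rel :=
  EquivRel _ torus_rel_refl torus_rel_sym torus_rel_trans.

End torus.

Definition torus (R : realType) : Type := {eq_quot (@torus_rel R)}.

HB.instance Definition _ (R : realType) := EqQuotient.on (torus R).
HB.instance Definition _ (R : realType) := Choice.on (torus R).

Definition torus_pi (R : realType) : plane R -> torus R := \pi_(torus R).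
Arguments torus_pi {R}.

Section torus_theory.
Context {R : realType}.
Implicit Types (u v w k : plane R) (x y z : torus R).

Lemma torus_piP u v : torus_pi u = torus_pi v <-> integral_vec (u - v).
Proof.
rewrite (_ : integral_vec _ = (torus_pi u == torus_pi v)).
  by split=> [->|/eqP].
by rewrite /torus_pi [in RHS]pi_eq_quot.
Qed.

Lemma torus_pi_surj x : exists u, torus_pi u = x.
Proof. by exists (repr x); rewrite /torus_pi reprK. Qed.

Lemma torus_piD u k : integral_vec k -> torus_pi (u + k) = torus_pi u.
Proof. by move=> ik; apply/torus_piP; rewrite addrAC subrr add0r. Qed.

(* The flat (quotient) distance on the torus. *)
Definition tdist x y : R :=
  inf [set edist u v | u in [set u | torus_pi u = x]
                     & v in [set v | torus_pi v = y]].

Let dset x y := [set edist u v | u in [set u | torus_pi u = x]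
                     & v in [set v | torus_pi v = y]].

Let dset0 x y : dset x y !=set0.
Proof.
have [u ux] := torus_pi_surj x; have [v vy] := torus_pi_surj y.
by exists (edist u v); exists u => //; exists v.
Qed.

Let dset_lb x y : has_lbound (dset x y).
Proof. by exists 0 => _ [u _ [v _ <-]]; exact: edist_ge0. Qed.

Lemma tdist_le u v : tdist (torus_pi u) (torus_pi v) <= edist u v.
Proof. by apply: (ge_inf (dset_lb _ _)); exists u => //; exists v. Qed.

Lemma tdist_ltP u y e :
  tdist (torus_pi u) y < e <-> exists2 v, torus_pi v = y & edist u v < e.
Proof.
split=> [/(inf_lt (dset0 _ _)) [_ [u' u'u [v vy <-]] ve]|[v <-]]; last first.
  exact/le_lt_trans/tdist_le.
exists (v + (u - u')); last by rewrite -(edistD2r (u - u')) subrKC in ve.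
by rewrite torus_piD//; apply/torus_piP.
Qed.

Lemma tdist_ge0 x y : 0 <= tdist x y.
Proof.
by apply: lb_le_inf (dset0 _ _) _ => _ [u _ [v _ <-]]; exact: edist_ge0.
Qed.

Let tdistxx x : tdist x x = 0.
Proof.
apply/eqP; rewrite eq_le tdist_ge0 andbT; have [u <-] := torus_pi_surj x.
by rewrite (le_trans (tdist_le u u))// edistxx.
Qed.

Let tdistC x y : tdist x y = tdist y x.
Proof.
rewrite /tdist; congr inf; apply/seteqP; split=> _ [u ux [v vy <-]];
  by exists v => //; exists u => //; rewrite edistC.
Qed.

Let tdist_triangle y x z : tdist x z <= tdist x y + tdist y z.
Proof.
apply/ler_addgt0Pl => e e0; have [u <-] := torus_pi_surj x.
have [|v vy uv] := (tdist_ltP u y (tdist (torus_pi u) y + e / 2)).1.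
  by rewrite ltrDl divr_gt0.
have [|w wz vw] := (tdist_ltP v z (tdist y z + e / 2)).1.
  by rewrite vy ltrDl divr_gt0.
rewrite -wz (le_trans (tdist_le u w))// (le_trans (edist_triangle v _ _))//.
rewrite (le_trans (ltW (ltrD uv vw)))// wz.
by rewrite [X in _ <= e + X]addrC (addrACA (tdist _ _)) -splitr addrC [X in e + X]addrC.
Qed.

Let tdist_eq0 x y : tdist x y = 0 -> x = y.
Proof.
move=> xy0; have [u ux] := torus_pi_surj x.
have small e : 0 < e -> exists2 v, torus_pi v = y & edist u v < e.
  by move=> e0; apply/tdist_ltP; rewrite ux xy0.
have [|v vy uv] := small (1 / 4); first by lra.
have [uv0|uv0] := eqVneq (edist u v) 0.
  by rewrite -ux -vy (edist0_eq uv0).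
have uv_gt0 : 0 < edist u v by rewrite lt_neqAle eq_sym uv0 edist_ge0.
have [v' v'y uv'] := small _ uv_gt0.
suff vv' : v = v' by rewrite -vv' ltxx in uv'.
have /torus_piP /andP[i1 i2] : torus_pi v = torus_pi v' by rewrite vy v'y.
have v'v : edist v v' < 1.
  rewrite (le_lt_trans (edist_triangle u _ _))// (edistC v u).
  by rewrite (lt_trans (ltrD uv (lt_trans uv' uv)))//; lra.
have int0 (r : R) : r \is a Num.int -> `|r| < 1 -> r = 0.
  by move=> ir; apply: contraTeq => /(norm_intr_ge1 ir); rewrite leNgt.
apply: plane_eq; apply/eqP; rewrite -subr_eq0; apply/eqP;
  apply: int0 => //; apply: le_lt_trans v'v; [exact: edist_fst|exact: edist_snd].
Qed.

HB.instance Definition _ := @isMetric.Build R (torus R) tdist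
  tdistxx tdist_eq0 tdistC tdist_triangle.

Lemma torus_mdistE x y : mdist x y = tdist x y. Proof. by []. Qed.

End torus_theory.

Section torus_topology.
Context {R : realType}.
Import metricType_numDomainType.

Lemma torus_pi_continuous : continuous (@torus_pi R).
Proof.
move=> u; apply/cvgrPdist_lt => e e0.
have e20 : 0 < e / 2 by rewrite divr_gt0.
apply: filterS (nbhsx_ballx u _ e20) => v [/= uv1 uv2].
rewrite (le_lt_trans (tdist_le _ _))// (le_lt_trans (edist_le _ _))//.
by rewrite [e]splitr ltrD.
Qed.

Lemma tdist_le2 (x y : torus R) : tdist x y <= 2.
Proof.
have [u <-] := torus_pi_surj x; have [v <-] := torus_pi_surj y.
pose fr (w : plane R) : plane R :=
  ((w.1 - (Num.floor w.1)%:~R), (w.2 - (Num.floor w.2)%:~R)).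
have frE w : torus_pi (fr w) = torus_pi w.
  have ir (r : R) : r - (Num.floor r)%:~R - r \is a Num.int.
    by rewrite addrAC subrr sub0r rpredN intr_int.
  by apply/torus_piP; apply/andP; split; exact: ir.
have fr01 (r : R) : 0 <= r - (Num.floor r)%:~R < 1.
  by rewrite subr_ge0 floor_le/= ltrBlDl -[X in _ + X]/(1%:~R) -rmorphD/= floorD1_gt.
rewrite -(frE u) -(frE v) (le_trans (tdist_le _ _))// (le_trans (edist_le _ _))//=.
have := fr01 u.1; have := fr01 u.2; have := fr01 v.1; have := fr01 v.2.
move=> /andP[? ?] /andP[? ?] /andP[? ?] /andP[? ?].
by rewrite (_ : 2 = 1 + 1)// lerD// ler_norml; apply/andP; split; lra.
Qed.

Lemma open_plane_measurable (U : set (plane R)) : open U -> measurable U.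
Proof.
move=> oU.
pose box (q : (rat * rat) * (rat * rat)) : set (plane R) :=
  `]ratr q.1.1, ratr q.1.2[ `*` `]ratr q.2.1, ratr q.2.2[.
have -> : U = \bigcup_(q in [set q | box q `<=` U]) box q.
  apply/seteqP; split=> [u Uu|u [q qU]]; last exact: qU.
  have /nbhs_ballP[e /= e0 eU] : nbhs u U by exact: open_nbhs_nbhs.
  have near (r : R) : exists q : rat * rat,
      ratr q.1 < r < ratr q.2 /\
      forall s, ratr q.1 < s < ratr q.2 -> `|r - s| < e.
    have [|a] := @rat_in_itvoo R (r - e) r; first by rewrite ltrBlDr ltrDl.
    have [|b] := @rat_in_itvoo R r (r + e); first by rewrite ltrDl.
    rewrite !in_itv/= => /andP[? ?] /andP[? ?]; exists (a, b) => /=; split.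
      by apply/andP.
    by move=> s /= /andP[? ?]; rewrite ltr_norml; apply/andP; split; lra.
  have [q1 [u1 b1]] := near u.1; have [q2 [u2 b2]] := near u.2.
  exists (q1, q2) => /=; last by split; rewrite /= in_itv.
  move=> v [/=]; rewrite !in_itv/= => v1 v2.
  by apply: eU; split; [exact: b1|exact: b2].
rewrite bigcup_mkcond; apply: countable_bigcupT_measurable => [|q].
  exact: countableP.
case: ifPn => // _; apply: measurableX; exact: measurable_itv.
Qed.

End torus_topology.

HB.instance Definition _ (R : realType) := isPointed.Build (torus R) (torus_pi 0).
(* Borel sigma-algebra of the torus. *)
HB.instance Definition _ (R : realType) :=
  Measurable.copy (torus R) (g_sigma_algebraType [set A : set (torus R) | open A]).

Section torus_leb.
Context {R : realType}.

Lemma torus_pi_measurable : measurable_fun [set: plane R] (@torus_pi R).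
Proof.
apply: (@measurability _ _ _ _ _ _ [set A : set (torus R) | open A]) => // _ [A oA <-].
rewrite setTI; apply: open_plane_measurable.
by apply: (open_comp _ oA) => u _; exact: torus_pi_continuous.
Qed.

Let square_measurable :
  measurable (`[0, 1[ `*` `[0, 1[ : set (measurableTypeR R * measurableTypeR R)).
Proof. by apply: measurableX; exact: measurable_itv. Qed.

(* Push-forward under the covering map of planar Lebesgue measure on the
   fundamental domain [0, 1)^2. *)
Definition torus_leb : set (torus R) -> \bar R :=
  pushforward (mrestr (lebesgue_measure \x lebesgue_measure)%E square_measurable)
    torus_pi.

Lemma torus_leb_setT : torus_leb [set: torus R] = 1%E.
Proof.
rewrite /torus_leb /pushforward /mrestr preimage_setT setTI.
rewrite product_measure1E//=; [|exact: measurable_itv..].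
by rewrite !lebesgue_measure_itv/= lte_fin ltr01 oppr0 adde0 mule1.
Qed.

End torus_leb.

Definition homeomorphism (T : topologicalType) (f : T -> T) :=
  continuous f /\ exists g : T -> T, [/\ continuous g, cancel f g & cancel g f].

Definition homotopic_id (R : realType) (f : torus R -> torus R) :=
  exists h : R * torus R -> torus R,
    [/\ {within `[0, 1] `*` setT, continuous h},
        forall x, h (0, x) = x & forall x, h (1, x) = f x].

Definition preserves_leb (R : realType) (f : torus R -> torus R) :=
  forall A : set (torus R), measurable A -> torus_leb (f @^-1` A) = torus_leb A.

Record homeo_leb (R : realType) := HomeoLeb {
  homeo_leb_fun :> torus R -> torus R;
  homeo_lebP : [/\ homeomorphism homeo_leb_fun, homotopic_id homeo_leb_fun
                 & preserves_leb homeo_leb_fun] }.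

HB.instance Definition _ (R : realType) := gen_eqMixin (homeo_leb R).
HB.instance Definition _ (R : realType) := gen_choiceMixin (homeo_leb R).

Section homeo_leb_metric.
Context {R : realType}.
Implicit Types f g h : homeo_leb R.

(* The metric of uniform convergence. *)
Definition unif_dist f g : R := sup [set mdist (f x) (g x) | x in setT].

Let unif_dist_ub f g x : mdist (f x) (g x) <= unif_dist f g.
Proof.
by apply: ub_le_sup; [exists 2 => _ [y _ <-]; exact: tdist_le2|exists x].
Qed.

Let unif_dist_lub f g (r : R) :
  (forall x, mdist (f x) (g x) <= r) -> unif_dist f g <= r.
Proof.
move=> fgr; apply: ge_sup => [|_ [x _ <-]//].
by exists (mdist (f point) (g point)), point.
Qed.

Let unif_distxx f : unif_dist f f = 0.
Proof.
apply/eqP; rewrite eq_le; apply/andP; split.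
  by apply: unif_dist_lub => x; rewrite mdistxx.
by rewrite (le_trans _ (unif_dist_ub f f point))// mdist_ge0.
Qed.

Let unif_dist_eq0 f g : unif_dist f g = 0 -> f = g.
Proof.
move=> fg0; have fg : f = g :> (torus R -> torus R).
  apply/funext => x; apply: mdist_positivity; apply/eqP.
  by rewrite eq_le mdist_ge0 andbT -fg0.
case: f g fg {fg0} => f pf [g pg] /= fg; subst g.
by congr HomeoLeb; exact: Prop_irrelevance.
Qed.

Let unif_distC f g : unif_dist f g = unif_dist g f.
Proof.
by rewrite /unif_dist; congr sup; apply: eq_imagel => x _; rewrite metric_sym.
Qed.

Let unif_dist_triangle g f h : unif_dist f h <= unif_dist f g + unif_dist g h.
Proof.
apply: unif_dist_lub => x.
by rewrite (le_trans (metric_triangle _ (g x) _))// lerD.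
Qed.

HB.instance Definition _ := @isMetric.Build R (homeo_leb R) unif_dist
  unif_distxx unif_dist_eq0 unif_distC unif_dist_triangle.

End homeo_leb_metric.

Section rotation.
Context {R : realType}.
Implicit Types (f : torus R -> torus R) (F : plane R -> plane R).

Definition is_lift f F := continuous F /\ torus_pi \o F = f \o torus_pi.

(* [M] and [m] range over positive integers, so that division by [m] makes
   sense; the sets being intersected decrease with [M]. *)
Definition rotation_set F : set (plane R) :=
  \bigcap_(M in [set M | (0 < M)%N])
    closure (\bigcup_(m in [set m | (M <= m)%N])
      [set m%:R^-1 *: (iter m F u - u) | u in setT]).

(* The set E_N of points of the torus. *)
Definition grid (N : nat) : set (torus R) :=
  [set torus_pi (i%:R / 2 ^+ N, j%:R / 2 ^+ N)
    | i in [set i | (i <= 2 ^ N - 1)%N] & j in [set j | (j <= 2 ^ N - 1)%N]].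

(* The lattice (2^-N Z)^2 of the plane. *)
Definition lattice (N : nat) : set (plane R) :=
  [set (i%:~R / 2 ^+ N, j%:~R / 2 ^+ N) | i in [set: int] & j in [set: int]].

(* [P] is a choice of a nearest point of E_N. *)
Definition grid_projection (N : nat) (P : torus R -> torus R) :=
  forall x, grid N (P x) /\ (forall y, grid N y -> mdist x (P x) <= mdist x y).

(* [Q] is a choice of a nearest point of (2^-N Z)^2 compatible with [P] and
   with integer translations. *)
Definition lattice_projection (N : nat) (P : torus R -> torus R)
    (Q : plane R -> plane R) :=
  [/\ forall u, lattice N (Q u) /\
        (forall w, lattice N w -> edist u (Q u) <= edist u w),
      forall u, torus_pi (Q u) = P (torus_pi u)
    & forall u k, integral_vec k -> Q (u + k) = Q u + k].

Variables (P : nat -> torus R -> torus R) (Q : nat -> plane R -> plane R).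

(* [discretization f N] and [lift_discretization F N] are total functions; f_N
   and F_N are their restrictions to E_N and (2^-N Z)^2, which they map into
   themselves. *)
Definition discretization f (N : nat) : torus R -> torus R := P N \o f.

Definition lift_discretization F (N : nat) : plane R -> plane R := Q N \o F.

(* [p] is any positive period of [x], not necessarily the least one. *)
Definition discrete_rotation_set f F (N : nat) : set (plane R) :=
  [set v | exists x p u, [/\ grid N x, (0 < p)%N,
      iter p (discretization f N) x = x, torus_pi u = x
    & v = p%:R^-1 *: (iter p (lift_discretization F N) u - u)]].

Definition asymptotic_rotation_set f F : set (plane R) :=
  \bigcap_(M in [set M | (0 < M)%N])
    closure (\bigcup_(N in [set N | (M <= N)%N]) discrete_rotation_set f F N).

End rotation.

(* Extended-real valued, so that no boundedness assumption is needed. *)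
Definition hausdorff_dist (R : realType) (A B : set (plane R)) : \bar R :=
  maxe (ereal_sup [set ereal_inf [set (edist a b)%:E | b in B] | a in A])
       (ereal_sup [set ereal_inf [set (edist a b)%:E | a in A] | b in B]).

(* Main.v *)
(* Everything rests on two elementary facts. First, a homeomorphism preserving
   Lebesgue measure is chain transitive, so a vector of the rotation set of F is
   approximated by rotation vectors of closed e-chains. Second, finitely many
   distinct points of the torus can be moved to arbitrary distinct nearby points
   by composing four small shears (x, y) |-> (x, y + s x), (x + s y, y).

   Given finitely many vectors a_i of rho(F) and a fine grid, realize the a_i by
   disjoint cycles of grid points that are e-chains of f, and let every other
   grid point go to the next point of a shortest e-chain towards these cycles.
   This map s of the grid is close to f and its only periodic orbits are the
   chosen cycles. Composing f with shears gives g close to f such that g sends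
   each grid point into the interior of the cell of its image under s, so that s
   is the discretization of every homeomorphism close enough to g, whose
   discretized rotation set is therefore close to {a_i}. In the same way,
   periodic orbits of discretizations of f are shadowed by long orbits of
   perturbations of f.

   To pass to generic f without any semicontinuity of the rotation set, use that
   S° U (complement of the closure of S°) is open and dense for every set S, and
   intersect these sets over countably many conditions S with rational data. *)
Require Import Defs.
From mathcomp Require Import all_boot all_order all_algebra.
From mathcomp Require Import all_classical all_reals all_analysis borel_hierarchy measurable_realfun.
From mathcomp Require Import ring lra zify.
Require Import Defs.

Set Implicit Arguments.
Unset Strict Implicit.
Unset Printing Implicit Defensive.

Import Order.TTheory GRing.Theory Num.Theory numFieldNormedType.Exports.

Local Open Scope classical_set_scope.
Local Open Scope ring_scope.

(** * Lifts of nearby maps *)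

(** A discretization need not be injective. The grid map imitating [f] only has to be close to [f],
    and points off the chosen cycles may collapse onto them, so no matching argument producing
    permutations of the grid is required. Injectivity concerns only the perturbing homeomorphism,
    and this is why coinciding targets are spread out inside one cell.

    Rotation sets belong to lifts, while the category argument takes place among maps of the torus.
    Hence every perturbation is built together with a lift close to [F], and every generic condition
    selects a lift by placing the image of the origin within 1/4 of a rational point; distinct lifts
    of one map differ by a nonzero integral vector, of norm at least 1. The compact sets [K] are
    uncountably many, but finite rational lists approximate them all. *)

Section metric_characterizations.
Context {R : realType}.
Implicit Types (u v w k : plane R) (x y z : torus R).

Lemma tdist_sym x y : tdist x y = tdist y x.
Proof. exact: (@metric_sym R (torus R)). Qed.

Lemma tdist_trans y x z : tdist x z <= tdist x y + tdist y z.
Proof. exact: (@metric_triangle R (torus R)). Qed.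

Lemma tdistxx x : tdist x x = 0.
Proof. exact: (@mdistxx R (torus R)). Qed.

Lemma tdist0_eq x y : tdist x y = 0 -> x = y.
Proof. exact: (@mdist_positivity R (torus R)). Qed.

Lemma plane_nbhsP u (A : set (plane R)) :
  nbhs u A <-> exists2 e, 0 < e & forall v, edist u v < e -> A v.
Proof.
split=> [/nbhs_ballP[e /= e0 eA]|[e e0 eA]].
  exists e => // v uv; apply: eA; split => /=.
    exact: le_lt_trans (edist_fst u v) uv.
  exact: le_lt_trans (edist_snd u v) uv.
apply/nbhs_ballP; exists (e / 2) => /=; first by rewrite divr_gt0.
move=> v [/= uv1 uv2]; apply: eA; rewrite (le_lt_trans (edist_le _ _))//.
by rewrite [ltRHS]splitr ltrD.
Qed.

Lemma metric_nbhsP (M : metricType R) (x : M) (A : set M) :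
  nbhs x A <-> exists2 e, 0 < e & forall y : M, mdist x y < e -> A y.
Proof.
split=> [/nbhs_ballP[e /= e0 eA]|[e e0 eA]].
  by exists e => // y xy; apply: eA; rewrite ballEmdist.
by apply/nbhs_ballP; exists e => // y; rewrite ballEmdist; exact: eA.
Qed.

Lemma torus_nbhsP x (A : set (torus R)) :
  nbhs x A <-> exists2 e, 0 < e & forall y, tdist x y < e -> A y.
Proof. exact: (@metric_nbhsP (torus R)). Qed.

Lemma plane_cvgP (F : plane R -> plane R) u :
  {for u, continuous F} <-> forall e, 0 < e -> exists2 d, 0 < d &
    forall v, edist u v < d -> edist (F u) (F v) < e.
Proof.
split=> [Fu e e0|FE A /plane_nbhsP[e e0 eA]].
  have /Fu/plane_nbhsP[d d0 dA] : nbhs (F u) [set v | edist (F u) v < e].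
    by apply/plane_nbhsP; exists e.
  by exists d.
have [d d0 dA] := FE e e0; apply/plane_nbhsP; exists d => // v /dA.
exact: eA.
Qed.

Lemma plane_torus_cvgP (F : plane R -> torus R) u :
  {for u, continuous F} <-> forall e, 0 < e -> exists2 d, 0 < d &
    forall v, edist u v < d -> tdist (F u) (F v) < e.
Proof.
split=> [Fu e e0|FE A /torus_nbhsP[e e0 eA]].
  have /Fu/plane_nbhsP[d d0 dA] : nbhs (F u) [set v | tdist (F u) v < e].
    by apply/torus_nbhsP; exists e.
  by exists d.
have [d d0 dA] := FE e e0; apply/plane_nbhsP; exists d => // v /dA.
exact: eA.
Qed.

Lemma torus_cvgP (f : torus R -> torus R) x :
  {for x, continuous f} <-> forall e, 0 < e -> exists2 d, 0 < d &
    forall y, tdist x y < d -> tdist (f x) (f y) < e.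
Proof.
split=> [Fu e e0|FE A /torus_nbhsP[e e0 eA]].
  have /Fu/torus_nbhsP[d d0 dA] : nbhs (f x) [set v | tdist (f x) v < e].
    by apply/torus_nbhsP; exists e.
  by exists d.
have [d d0 dA] := FE e e0; apply/torus_nbhsP; exists d => // v /dA.
exact: eA.
Qed.

Lemma integral_vec_eq0 k : integral_vec k -> edist k 0 < 1 -> k = 0.
Proof.
move=> /andP[k1 k2] kl1.
have int0 (r : R) : r \is a Num.int -> `|r| < 1 -> r = 0.
  by move=> ir; apply: contraTeq => /(norm_intr_ge1 ir); rewrite leNgt.
apply: plane_eq; apply: int0 => //; apply: le_lt_trans kl1.
  by rewrite -[k.1]subr0; exact: (edist_fst k 0).
by rewrite -[k.2]subr0; exact: (edist_snd k 0).
Qed.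

Lemma lift_unique v w : torus_pi v = torus_pi w -> edist v w < 1 -> v = w.
Proof.
move=> /torus_piP vw vw1; apply/eqP; rewrite -subr_eq0; apply/eqP.
apply: integral_vec_eq0 => //; suff <- : edist v w = edist (v - w) 0 by [].
by rewrite -(edistD2r (- w)) subrr.
Qed.

Definition equivariant (F : plane R -> plane R) :=
  forall u k, integral_vec k -> F (u + k) = F u + k.

Lemma equivariant_torus F u v : equivariant F ->
  torus_pi u = torus_pi v -> F u - u = F v - v.
Proof.
move=> eF /torus_piP uv; rewrite -{1 2}(subrK v u) addrC addrC.
rewrite (addrC _ v) eF//.
by rewrite opprD addrACA subrr addr0.
Qed.

Lemma equivariant_pi F u v : equivariant F ->
  torus_pi u = torus_pi v -> torus_pi (F u) = torus_pi (F v).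
Proof.
move=> eF uv; apply/torus_piP.
have /torus_piP := uv; rewrite (_ : F u - F v = u - v)//.
by have /eqP := equivariant_torus eF uv; rewrite subr_eq => /eqP ->; ring.
Qed.

Lemma equivariant_comp F F' :
  equivariant F -> equivariant F' -> equivariant (F \o F').
Proof. by move=> eF eF' u k ik /=; rewrite eF' ?eF. Qed.

Lemma is_lift_comp (f f' : torus R -> torus R) (F F' : plane R -> plane R) :
  is_lift f F -> is_lift f' F' -> is_lift (f \o f') (F \o F').
Proof.
move=> [cF fF] [cF' fF']; split.
  by move=> u; apply: continuous_comp; [exact: cF'|exact: cF].
apply/funext => u /=.
have /(congr1 (fun h => h (F' u))) /= -> := fF.
by have /(congr1 (fun h => h u)) /= -> := fF'.
Qed.

Lemma is_liftE (f : torus R -> torus R) F u :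
  is_lift f F -> torus_pi (F u) = f (torus_pi u).
Proof. by case=> _ /(congr1 (fun h => h u)). Qed.

End metric_characterizations.

Section nearby_lift.
Context {R : realType}.

(* The lift of [h (torus_pi u)] within distance [r] of [G u] is unique, which
   makes it continuous and equivariant in [u]. *)
Lemma nearby_lift (g h : torus R -> torus R) (G : plane R -> plane R) (r : R) :
  is_lift g G -> continuous h -> r <= 1 / 4 ->
  (forall x, tdist (g x) (h x) < r) ->
  exists H, [/\ is_lift h H, forall u, edist (G u) (H u) < r
    & equivariant G -> equivariant H].
Proof.
move=> gG ch r14 gh.
have exH u : exists v, torus_pi v = h (torus_pi u) /\ edist (G u) v < r.
  have [|v vh Gv] := (tdist_ltP (G u) (h (torus_pi u)) r).1.
    by rewrite (is_liftE _ gG).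
  by exists v.
have {exH}[H HP] := choice exH; exists H; split; last first.
- move=> eG u k ik; have [Hu Gu] := HP u; have [Huk Guk] := HP (u + k).
  apply: lift_unique; first by rewrite Huk !torus_piD.
  have := edist_triangle (G (u + k)) (H (u + k)) (H u + k).
  by rewrite (edistC (H (u + k)) (G (u + k))) {2}eG// edistD2r; lra.
- by move=> u; case: (HP u).
split; last by apply/funext => u /=; case: (HP u).
move=> u; apply/plane_cvgP => e e0.
have e'0 : 0 < Num.min e (1 / 4) by rewrite lt_min e0; lra.
have /plane_torus_cvgP/(_ _ e'0)[d1 d10 hd1] :
    {for u, continuous (h \o torus_pi)}.
  by apply: continuous_comp; [exact: torus_pi_continuous|exact: ch].
have /plane_cvgP/(_ (1/4) ltac:(lra))[d2 d20 Gd2] := gG.1 u.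
exists (Num.min d1 d2); first by rewrite lt_min d10.
move=> v; rewrite lt_min => /andP[/hd1 /= uv1 /Gd2 uv2].
have [Hu Gu] := HP u; have [Hv Gv] := HP v.
move: uv1; rewrite -Hu => /tdist_ltP[w wv]; rewrite lt_min => /andP[we w4].
(* [w] and [H v] lift the same point; the path through [H u], [G u] and [G v] has four pieces of at
   most 1/4, the first of them strictly smaller, so they are less than 1 apart. *)
suff <- : w = H v by [].
apply: lift_unique; first by rewrite wv Hv.
have := edist_triangle (H u) w (H v); have := edist_triangle (G u) (H u) (H v).
have := edist_triangle (G v) (G u) (H v).
by rewrite (edistC w (H u)) (edistC (H u) (G u)); lra.
Qed.

End nearby_lift.

(** * Compactness and lifts of maps homotopic to the identity *)

Section compactness.
Context {R : realType}.
Implicit Types (u v w k : plane R).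

(** The usual passage from local radii to a common one; monotonicity in [d] turns a local radius
    into a property of all small [d], the form used by near-coverings. *)
Lemma compact_uniform (M : topologicalType) (K : set M) (P : R -> M -> Prop) :
  compact K -> (forall d d' x, d' <= d -> P d x -> P d' x) ->
  (forall x, K x -> exists2 d, 0 < d & \forall x' \near x, K x' -> P d x') ->
  exists2 d, 0 < d & forall x, K x -> P d x.
Proof.
move=> /compact_near_coveringP/near_covering_withinP cK mP lP.
have h x : K x -> \forall x' \near x & d \near (0 : R)^'+, K x' -> P d x'.
  move=> /lP[d d0 dP].
  exists ([set x' | K x' -> P d x'], [set d' | d' < d]) => /=.
    by split => //; exact: nbhs_right_lt.
  by move=> [x' d'] /= [h1 h2] /h1; apply: mP; exact: ltW.
have KP : \forall d \near (0 : R)^'+, K `<=` P d by exact: cK.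
have : \forall d \near (0 : R)^'+, 0 < d /\ K `<=` P d.
  by near=> d; split; near: d; [exact: nbhs_right_gt|exact: KP].
by move=> /filter_ex[d [d0 dP]]; exists d.
Unshelve. all: by end_near. Qed.

Definition frac (r : R) : R := r - (Num.floor r)%:~R.

Lemma frac_itv r : 0 <= frac r < 1.
Proof.
rewrite /frac subr_ge0 floor_le/= ltrBlDl.
by rewrite -[X in _ + X]/(1%:~R) -rmorphD/= floorD1_gt.
Qed.

Lemma frac_int r : frac r - r \is a Num.int.
Proof. by rewrite /frac addrAC subrr sub0r rpredN intr_int. Qed.

Lemma frac_diff r s : r - s \is a Num.int -> frac r = frac s.
Proof.
move=> /intrP[m rs]; have -> : r = s + m%:~R by rewrite -rs; ring.
by rewrite /frac floorDrz ?intr_int// intrKfloor rmorphD/=; ring.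
Qed.

Definition frac_vec u : plane R := (frac u.1, frac u.2).

Lemma frac_vec_pi u : torus_pi (frac_vec u) = torus_pi u.
Proof. by apply/torus_piP/andP; split; exact: frac_int. Qed.

Definition unit_square : set (plane R) := `[0, 1] `*` `[0, 1].

Lemma frac_vec_square u : unit_square (frac_vec u).
Proof.
have /andP[? ?] := frac_itv u.1; have /andP[? ?] := frac_itv u.2.
by split; rewrite /= in_itv/=; apply/andP; split => //; exact: ltW.
Qed.

Lemma unit_square_compact : compact unit_square.
Proof. by apply: compact_setX; exact: segment_compact. Qed.

Lemma torus_compact : compact [set: torus R].
Proof.
suff -> : [set: torus R] = torus_pi @` unit_square.
  apply: continuous_compact; last exact: unit_square_compact.
  by apply: continuous_subspaceT => u; exact: torus_pi_continuous.
apply/seteqP; split=> // x _; have [u <-] := torus_pi_surj x.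
by exists (frac_vec u); [exact: frac_vec_square|exact: frac_vec_pi].
Qed.

Lemma continuous_pair (T U V : topologicalType) (a : T -> U) (b : T -> V) :
  continuous a -> continuous b -> continuous (fun x => (a x, b x)).
Proof. by move=> ca cb x; exact: (cvg_pair (ca x) (cb x)). Qed.

(** Connectedness of the plane, reduced to that of the real line by pulling [A] back along the line
    through [u] and [v]. *)
Lemma plane_clopen (A : set (plane R)) u v :
  open A -> closed A -> A u -> A v.
Proof.
move=> oA cA Au.
pose c (t : R) : plane R := (u.1 + t * (v.1 - u.1), u.2 + t * (v.2 - u.2)).
have cc : continuous c.
  by apply: continuous_pair => t; apply: cvgD;
    [exact: cvg_cst|apply: cvgM; [exact: cvg_id|exact: cvg_cst]
    |exact: cvg_cst|apply: cvgM; [exact: cvg_id|exact: cvg_cst]].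
have conn : connected [set: R].
  by apply/connected_intervalP => ? ? _ _ ? _.
suff : c @^-1` A = setT.
  move=> /seteqP[_ /(_ 1 I)] /=.
  by rewrite /c !mul1r !subrKC; case: (v).
apply: conn.
- by exists 0; rewrite /= /c !mul0r !addr0; case: (u) Au.
- exists (c @^-1` A); last by rewrite setTI.
  by apply: open_comp => // t _; exact: cc.
- exists (c @^-1` A); last by rewrite setTI.
  by apply: preimage_closed.
Qed.

Lemma torus_clopen (A : set (torus R)) (x y : torus R) :
  open A -> closed A -> A x -> A y.
Proof.
have [u <-] := torus_pi_surj x; have [v <-] := torus_pi_surj y.
move=> oA cA Au; apply: (@plane_clopen (torus_pi @^-1` A) u) => //.
  by apply: open_comp => // w _; exact: torus_pi_continuous.
by apply: preimage_closed => // w _; exact: torus_pi_continuous.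
Qed.

(** The difference of two lifts is continuous with integral values, hence locally constant, so the
    set where it takes its value at the origin is clopen. *)
Lemma lifts_differ (f : torus R -> torus R) (F G : plane R -> plane R) :
  is_lift f F -> is_lift f G ->
  exists2 k, integral_vec k & forall u, F u = G u + k.
Proof.
move=> fF fG; have FG u : integral_vec (F u - G u).
  by apply/torus_piP; rewrite (is_liftE _ fF) (is_liftE _ fG).
exists (F 0 - G 0) => // u; pose A := [set v | F v - G v = F 0 - G 0].
have locc v : \forall w \near v, F w - G w = F v - G v.
  apply/plane_nbhsP.
  have /plane_cvgP/(_ (1/4) ltac:(lra))[d1 d10 Fd] := fF.1 v.
  have /plane_cvgP/(_ (1/4) ltac:(lra))[d2 d20 Gd] := fG.1 v.
  exists (Num.min d1 d2); first by rewrite lt_min d10.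
  move=> w; rewrite lt_min => /andP[/Fd Fw /Gd Gw].
  apply/eqP; rewrite -subr_eq0; apply/eqP; apply: integral_vec_eq0.
    by rewrite integral_vecD// integral_vecN.
  rewrite (_ : F w - G w - (F v - G v) = (F w - F v) + (G v - G w)); last by ring.
  rewrite -(edistD2r (G w - G v)) add0r.
  rewrite (_ : _ + (G w - G v) = F w - F v); last by ring.
  have := edist_triangle 0 (F w - F v) (G w - G v).
  rewrite -(edistD2r (F v) (F w - F v) 0) subrK add0r (edistC _ (F v)).
  by rewrite -(edistD2r (G v) 0 (G w - G v)) subrK add0r; lra.
have : A u.
  apply: (@plane_clopen A 0) => //.
    move=> v /= Av; apply: filterS (locc v) => w; rewrite /A/= => ->.
    exact: Av.
  move=> v /= clA; have [w [Aw wv]] := clA _ (locc v).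
  by rewrite /A/= -wv.
by rewrite /A/= => /eqP; rewrite subr_eq => /eqP ->; rewrite addrC.
Qed.

(** The homotopy is cut into time steps that move every point by less than 1/4. Starting from the
    identity of the plane, [nearby_lift] lifts one slice after another and carries equivariance
    along. *)
Lemma homotopic_id_lift (f : torus R -> torus R) :
  homotopic_id f -> exists2 F, is_lift f F & equivariant F.
Proof.
move=> [h [ch h0 h1]].
pose K : set (R * torus R) := `[0, 1] `*` setT.
have cK : compact K.
  by apply: compact_setX; [exact: segment_compact|exact: torus_compact].
(* Uniform continuity in time; [t] stays in the unit interval because the homotopy is only
   continuous there. *)
pose P (d : R) (p : R * torus R) := forall t, 0 <= t <= 1 -> `|t - p.1| < d ->
  tdist (h p) (h (t, p.2)) < 1 / 4.
have [d d0 dP] : exists2 d, 0 < d & forall x, K x -> P d x.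
  apply: compact_uniform => //.
    by move=> d d' x d'd Pd t t01 td; apply: Pd => //; exact: lt_le_trans d'd.
  move=> p Kp; have /subspace_continuousP/(_ p Kp) := ch.
  have hN : nbhs (h p) [set y | tdist (h p) y < 1 / 8].
    by apply/torus_nbhsP; exists (1 / 8) => //; lra.
  move=> /(_ _ hN) /nbhs_ballP[e /= e0 eP].
  exists (e / 2); first by rewrite divr_gt0.
  have e20 : 0 < e / 2 by rewrite divr_gt0.
  apply/nbhs_ballP; exists (e / 2) => // q [/= q1 q2] Kq t t01 tq.
  have hq : tdist (h p) (h q) < 1 / 8.
    apply: eP => //; split => /=.
      by apply: le_ball q1; rewrite ler_pdivrMr// ler_pMr// ler1n.
    by apply: le_ball q2; rewrite ler_pdivrMr// ler_pMr// ler1n.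
  have ht : tdist (h p) (h (t, q.2)) < 1 / 8.
    apply: eP; last by split => //=; rewrite in_itv.
    split => /=; last first.
      by apply: le_ball q2; rewrite ler_pdivrMr// ler_pMr// ler1n.
    move: q1; rewrite /ball/= => q1.
    have := ler_distD q.1 p.1 t; rewrite (distrC q.1 t).
    lra.
  have := tdist_trans (h p) (h q) (h (t, q.2)).
  by rewrite tdist_sym in hq; lra.
pose n := (Num.truncn (d^-1)).+1.
have n0 : 0 < n%:R :> R by rewrite ltr0n.
have nd : n%:R^-1 < d.
  by rewrite invf_plt ?posrE// truncnS_gt.
have hc t : 0 <= t <= 1 -> continuous (fun x => h (t, x)).
  move=> t01 x; apply/torus_cvgP => e e0.
  have /subspace_continuousP/(_ (t, x)) := ch.
  have hN : nbhs (h (t, x)) [set y | tdist (h (t, x)) y < e].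
    by apply/torus_nbhsP; exists e.
  have Ktx : K (t, x) by split => //=; rewrite in_itv.
  move=> /(_ Ktx _ hN) /nbhs_ballP[e' /= e'0 eP]; exists e' => // y xy.
  apply: (eP (t, y)); last by split => //=; rewrite in_itv.
  by split => /=; [exact: ballxx|rewrite ballEmdist].
have ht i : (i <= n)%N ->
    exists2 F, is_lift (fun x => h (i%:R / n%:R, x)) F & equivariant F.
  elim: i => [_|i IH iltn].
    exists id => //; split; first by move=> u; exact: cvg_id.
    by apply/funext => u; rewrite /= mul0r h0.
  have [F lF eF] := IH (ltnW iltn).
  have i01 : 0 <= (i%:R / n%:R : R) <= 1.
    by rewrite divr_ge0//= ler_pdivrMr// mul1r ler_nat ltnW.
  have i101 : 0 <= (i.+1%:R / n%:R : R) <= 1.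
    by rewrite divr_ge0//= ler_pdivrMr// mul1r ler_nat.
  have [|H [lH _ eH]] := nearby_lift lF (hc _ i101) (lexx _).
    move=> x; apply: (dP (_, x)) => //=.
    by rewrite -mulrBl -natrB// subSnn mul1r ger0_norm// invr_ge0.
  by exists H => //; exact: eH.
have [F lF eF] := ht n (leqnn n); exists F => //.
by move: lF; rewrite divff ?lt0r_neq0//; congr is_lift; apply/funext => x.
Qed.

Lemma lift_equivariant (f : torus R -> torus R) (F : plane R -> plane R) :
  homotopic_id f -> is_lift f F -> equivariant F.
Proof.
move=> /homotopic_id_lift[G fG eG] fF; have [k ik FG] := lifts_differ fF fG.
by move=> u l il; rewrite !FG eG// addrAC.
Qed.

End compactness.

(** * Uniform continuity, and homeomorphisms built from their lifts *)

Section uniformity.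
Context {R : realType}.
Implicit Types (u v w k : plane R) (x y : torus R) (F : plane R -> plane R).

Lemma torus_ucont (f : torus R -> torus R) e : continuous f -> 0 < e ->
  exists2 d, 0 < d & forall x y, tdist x y < d -> tdist (f x) (f y) < e.
Proof.
move=> cf e0.
pose P d x := forall y, tdist x y < d -> tdist (f x) (f y) < e.
have [d d0 dP] : exists2 d, 0 < d & forall x, setT x -> P d x.
  apply: compact_uniform; first exact: torus_compact.
    by move=> d d' x d'd Pd y xy; apply: Pd; exact: lt_le_trans d'd.
  move=> x _; have /torus_cvgP/(_ (e / 2) ltac:(lra))[d d0 fd] := cf x.
  exists (d / 2); first lra.
  apply/torus_nbhsP; exists (d / 2); first lra.
  move=> y xy _ z yz.
  have fy := fd y ltac:(lra).
  have fz : tdist (f x) (f z) < e / 2.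
    by apply: fd; have := tdist_trans y x z; lra.
  have := tdist_trans (f x) (f y) (f z); rewrite (tdist_sym (f y) (f x)); lra.
by exists d => // x y; exact: dP.
Qed.

(** Compactness gives a modulus at points of the unit square, with [v] free in the plane; an
    integral translation carries it to every [u]. *)
Lemma lift_ucont F e : continuous F -> equivariant F -> 0 < e ->
  exists2 d, 0 < d & forall u v, edist u v < d -> edist (F u) (F v) < e.
Proof.
move=> cF eF e0.
pose P d u := forall v, edist u v < d -> edist (F u) (F v) < e.
have [d d0 dP] : exists2 d, 0 < d & forall u, unit_square u -> P d u.
  apply: compact_uniform; first exact: unit_square_compact.
    by move=> d d' u d'd Pd v uv; apply: Pd; exact: lt_le_trans d'd.
  move=> u _; have /plane_cvgP/(_ (e / 2) ltac:(lra))[d d0 fd] := cF u.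
  exists (d / 2); first lra.
  apply/plane_nbhsP; exists (d / 2); first lra.
  move=> v uv _ w vw.
  have fv := fd v ltac:(lra).
  have fw : edist (F u) (F w) < e / 2.
    by apply: fd; have := edist_triangle v u w; lra.
  have := edist_triangle (F u) (F v) (F w); rewrite (edistC (F v) (F u)); lra.
exists d => // u v uv.
have /torus_piP iu := frac_vec_pi u.
have := dP _ (frac_vec_square u) (v + (frac_vec u - u)).
rewrite -{1 3}(subrK u (frac_vec u)) (addrC _ u) !eF// !edistD2r.
exact.
Qed.

Lemma lift_bounded F : continuous F -> equivariant F ->
  exists2 D, 0 < D & forall u, edist (F u) u <= D.
Proof.
move=> cF eF; have cN : compact ((fun u => F u - u) @` unit_square).
  apply: continuous_compact; last exact: unit_square_compact.
  by apply: continuous_subspaceT => u; apply: cvgB; [exact: cF|exact: cvg_id].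
have [M [_ /(_ (`|M| + 1))]] := compact_bounded cN.
move=> /(_ ltac:(by rewrite (le_lt_trans (ler_norm _))// ltrDl)) MP.
(* The factor 2 passes from the sup norm, in which the compact image is bounded, to [edist]. *)
exists (2 * (`|M| + 1)).
  by rewrite mulr_gt0// ltr_wpDl.
move=> u; have := MP _ (ex_intro2 _ _ _ (frac_vec_square u) erefl).
rewrite /= (equivariant_torus eF (frac_vec_pi u)) => Mu.
rewrite (le_trans (edist_le _ _))// mulr_natl mulr2n.
by move: Mu; rewrite prod_normE ge_max => /andP[M1 M2]; exact: lerD.
Qed.

Lemma lift_continuous (f : torus R -> torus R) F :
  is_lift f F -> continuous f.
Proof.
move=> fF x; apply/torus_cvgP => e e0; have [u <-] := torus_pi_surj x.
have /plane_torus_cvgP/(_ e e0)[d d0 dP] : {for u, continuous (torus_pi \o F)}.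
  by apply: continuous_comp; [exact: fF.1|exact: torus_pi_continuous].
exists d => // y /tdist_ltP[v <- /dP].
by rewrite -!(is_liftE _ fF).
Qed.

(** The straight segment from [u] to [F u] descends to the torus, because equivariance makes
    [F u - u] depend on [torus_pi u] only. *)
Lemma equivariant_homotopic (f : torus R -> torus R) F :
  is_lift f F -> equivariant F -> homotopic_id f.
Proof.
move=> fF eF.
pose H (p : R * plane R) : plane R := p.2 + p.1 *: (F p.2 - p.2).
pose h (p : R * torus R) := torus_pi (H (p.1, repr p.2)).
have pirepr x : torus_pi (repr x) = x by rewrite /torus_pi reprK.
have hE t u : h (t, torus_pi u) = torus_pi (H (t, u)).
  rewrite /h /H/=; have := pirepr (torus_pi u); set v := repr _ => vu.
  by rewrite (equivariant_torus eF vu); apply/torus_piP; rewrite opprD addrACA subrr addr0; apply/torus_piP.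
have cH : continuous H.
  move=> p; apply: cvgD; first exact: cvg_snd.
  apply: cvgZ; first exact: cvg_fst.
  apply: cvgB; last exact: cvg_snd.
  by apply: (@continuous_comp _ _ _ snd F); [exact: cvg_snd|exact: fF.1].
exists h; split.
- apply: continuous_subspaceT => -[t x]; have [u <-] := torus_pi_surj x.
  move=> A; rewrite /= hE => /torus_nbhsP[e e0 eA].
  have /nbhs_ballP[d /= d0 dP] : nbhs (t, u) [set p | tdist (torus_pi (H (t, u))) (torus_pi (H p)) < e].
    have c : {for (t, u), continuous (torus_pi \o H)}.
      by apply: continuous_comp; [exact: cH|exact: torus_pi_continuous].
    suff /c : nbhs (torus_pi (H (t, u)))
        [set y | tdist (torus_pi (H (t, u))) y < e] by [].
    by apply/torus_nbhsP; exists e.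
  apply/nbhs_ballP; exists d => // -[s y] [/= ts].
  rewrite ballEmdist/= => /tdist_ltP[v <- uv]; rewrite hE; apply: eA.
  apply: (dP (s, v)); split => //=; split => /=.
    exact: le_lt_trans (edist_fst u v) uv.
  exact: le_lt_trans (edist_snd u v) uv.
- by move=> x; rewrite /h/H/= scale0r addr0 pirepr.
- by move=> x; rewrite /h/H/= scale1r addrC subrK (is_liftE _ fF) pirepr.
Qed.

Lemma homeo_lebE (f : homeo_leb R) : [/\ continuous f,
  exists g : torus R -> torus R, [/\ continuous g, cancel f g & cancel g f],
  homotopic_id f & preserves_leb f].
Proof. by case: (homeo_lebP f) => -[? ?] ? ?. Qed.

Lemma homeo_leb_cont (f : homeo_leb R) : continuous f.
Proof. by case: (homeo_lebE f). Qed.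

Lemma homeo_leb_equivariant (f : homeo_leb R) F : is_lift f F -> equivariant F.
Proof. by case: (homeo_lebE f) => _ _ fi _; exact: lift_equivariant. Qed.

Lemma homeo_leb_inj (f : homeo_leb R) : injective f.
Proof. by case: (homeo_lebE f) => _ [g [_ fg _]] _ _; exact: can_inj fg. Qed.

Lemma homeo_leb_build (f g : torus R -> torus R) F G :
  is_lift f F -> equivariant F -> is_lift g G ->
  cancel f g -> cancel g f -> preserves_leb f ->
  exists h : homeo_leb R, h = f :> (_ -> _).
Proof.
move=> fF eF gG fg gf pf; unshelve eexists.
  apply: (@HomeoLeb _ f); split => //; last exact: equivariant_homotopic eF.
  split; first exact: lift_continuous fF.
  by exists g; split => //; exact: lift_continuous gG.
by [].
Qed.

Lemma continuous_preimage_measurable (f : torus R -> torus R) A :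
  continuous f -> measurable A -> measurable (f @^-1` A).
Proof.
move=> cf mA; have mf : measurable_fun [set: torus R] f.
  apply: (@measurability _ _ _ _ _ _ [set A : set (torus R) | open A]) => //.
  move=> _ [B oB <-]; rewrite setTI; apply: sub_sigma_algebra.
  by apply: open_comp oB => x _; exact: cf.
by rewrite -[X in measurable X]setTI; exact: mf.
Qed.

Lemma preserves_leb_comp (f g : torus R -> torus R) :
  continuous f -> preserves_leb f -> preserves_leb g -> preserves_leb (f \o g).
Proof.
move=> cf pf pg A mA; rewrite comp_preimage pg ?pf//.
exact: continuous_preimage_measurable.
Qed.

Lemma homeo_leb_comp (f g : homeo_leb R) :
  exists h : homeo_leb R, h = f \o g :> (_ -> _).
Proof.
have [cf [f' [cf' ff' f'f]] hf pf] := homeo_lebE f.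
have [cg [g' [cg' gg' g'g]] hg pg] := homeo_lebE g.
unshelve eexists.
  apply: (@HomeoLeb _ (f \o g)); split.
  - split; first by move=> x; apply: continuous_comp; [exact: cg|exact: cf].
    exists (g' \o f'); split.
    + by move=> x; apply: continuous_comp; [exact: cf'|exact: cg'].
    + by move=> x /=; rewrite ff' gg'.
    + by move=> x /=; rewrite g'g f'f.
  - have [F fF eF] := homotopic_id_lift hf.
    have [G gG eG] := homotopic_id_lift hg.
    exact: equivariant_homotopic (is_lift_comp fF gG) (equivariant_comp eF eG).
  - exact: preserves_leb_comp.
by [].
Qed.

Lemma unif_dist_tdist (f g : homeo_leb R) x : tdist (f x) (g x) <= unif_dist f g.
Proof.
by apply: ub_le_sup; [exists 2 => _ [y _ <-]; exact: tdist_le2|exists x].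
Qed.

Lemma unif_dist_le (f g : homeo_leb R) (r : R) :
  (forall x, tdist (f x) (g x) <= r) -> unif_dist f g <= r.
Proof.
move=> fgr; apply: ge_sup => [|_ [x _ <-]]; last exact: fgr.
by exists (mdist (f point) (g point)), point.
Qed.

End uniformity.

(** * Shears preserve Lebesgue measure *)

Section shear_measure.
Context {R : realType}.
Local Notation mu := (@lebesgue_measure R).

Lemma measurable_shift (c : R) (A : set (measurableTypeR R)) :
  measurable A -> measurable ((fun y : R => y + c) @^-1` A).
Proof.
move=> mA; rewrite -[X in measurable X]setTI.
have cs : continuous (fun y : R => y + c).
  by move=> y; apply: cvgD; [exact: cvg_id|exact: cvg_cst].
exact: (continuous_measurable_fun cs measurableT mA).
Qed.

Lemma lebesgue_measure_shift (c : R) (A : set (measurableTypeR R)) :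
  measurable A -> mu ((fun y : R => y + c) @^-1` A) = mu A.
Proof.
move=> mA.
have mc : measurable_fun [set: measurableTypeR R]
    ((fun y : R => y + c) : _ -> measurableTypeR R).
  by move=> _ B mB; rewrite setTI; exact: measurable_shift.
have := @lebesgue_measure_unique R (pushforward mu
  ((fun y : R => y + c) : _ -> measurableTypeR R)).
move=> /(_ mc) H; apply/esym/H => // _ [[a b]] _ <-.
transitivity (mu `]a - c, b - c]%classic); last first.
  by congr (mu _); apply/seteqP; split=> x /=; rewrite !in_itv/= ltrBlDr lerBrDr.
rewrite [RHS]lebesgue_measure_itv [LHS]lebesgue_measure_itv/= !lte_fin ltrD2r.
by case: ifPn => // _; rewrite -!EFinD; congr EFin; ring.
Qed.

(** After reducing [s] mod 1, the translation turns the unit interval into [[s, 1 + s[], and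
    periodicity brings the part beyond 1 back to [[0, s[]. *)
Lemma lebesgue_measure_periodic (s : R) (B : set (measurableTypeR R)) :
  measurable B -> (forall y k : R, k \is a Num.int -> B (y + k) <-> B y) ->
  mu ([set y | B (y + s)] `&` `[0, 1[) = mu (B `&` `[0, 1[).
Proof.
move=> mB pB; wlog : s / 0 <= s < 1 => [wl|/andP[s0 s1]].
  rewrite -(wl (frac s)) ?frac_itv//; congr (mu (_ `&` _)).
  apply/seteqP; split=> y /=; rewrite (_ : y + frac s = y + s + (frac s - s));
    by [move/(pB (y + s)); apply; exact: frac_int|ring
       |move=> By; apply/(pB (y + s)) => //; exact: frac_int].
have mI a b : measurable (B `&` `[a, b[).
  by apply: measurableI => //; exact: measurable_itv.
have split_itv a b c : a <= b -> b <= c ->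
    mu (B `&` `[a, c[) = (mu (B `&` `[a, b[) + mu (B `&` `[b, c[))%E.
  move=> ab bc; rewrite -measureU//; first last.
    apply/seteqP; split=> // y [[_ /=]]; rewrite in_itv/= => /andP[_ yb] [_].
    by rewrite /= in_itv/= => /andP[]; rewrite leNgt yb.
  congr (mu _); rewrite -setIUr; congr (_ `&` _).
  by apply: itv_bndbnd_setU; rewrite bnd_simp.
have -> : [set y | B (y + s)] `&` `[0, 1[ =
    (fun y : R => y + s) @^-1` (B `&` `[s, 1 + s[).
  apply/seteqP; split=> y /=; rewrite !in_itv/= lerDr ltrD2r.
    by move=> [? /andP[-> ->]].
  by move=> [? /andP[-> ->]].
rewrite lebesgue_measure_shift// (split_itv s 1) ?lerDl//; last exact: ltW.
rewrite (split_itv 0 s 1 s0 (ltW s1)) addeC; congr (_ + _)%E.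
rewrite -(lebesgue_measure_shift 1)//; congr (mu _).
apply/seteqP; split=> y /=; rewrite !in_itv/= lerDr (addrC 1) ltrD2r;
  by move=> [By ->]; split => //; apply/(pB y 1).
Qed.

Local Notation tleb := (@torus_leb R).

Lemma torus_lebE (A : set (torus R)) : tleb A =
  (\int[mu]_x mu ([set y | A (torus_pi (x, y)) /\ (0 <= (x : R) < 1)%R]
                  `&` `[0%R, 1%R[))%E.
Proof.
rewrite /torus_leb /pushforward /mrestr /product_measure1.
apply: eq_integral => x _ /=; congr (mu _).
apply/seteqP; split=> y; rewrite /xsection/= inE/=; first by move=> [? []].
by move=> [[]].
Qed.

Lemma section_measurable (A : set (torus R)) (x : R) :
  measurable A -> measurable [set y : measurableTypeR R | A (torus_pi (x, y))].
Proof.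
move=> mA.
have mpA : measurable (torus_pi @^-1` A).
  by rewrite -[X in measurable X]setTI; exact: torus_pi_measurable.
rewrite (_ : [set y | _] = xsection (torus_pi @^-1` A) x).
  exact: measurable_xsection.
by apply/seteqP; split=> y; rewrite /xsection/= inE.
Qed.

Definition vshear (s : R -> R) (u : plane R) : plane R := (u.1, u.2 + s u.1).

(** Fubini over vertical lines: on the line of abscissa [x] the shear is the translation by [s x],
    acting on a 1-periodic set. *)
Lemma vshear_preserves_leb (s : R -> R) (f : torus R -> torus R) :
  torus_pi \o vshear s = f \o torus_pi -> preserves_leb f.
Proof.
move=> sf A mA; rewrite !torus_lebE; apply: eq_integral => x _.
have [x01|x01] := boolP (0 <= (x : R) < 1); last first.
  by congr (mu (_ `&` _)); apply/seteqP; split=> y /= [].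
rewrite (_ : [set y | A _ /\ _] = [set y | A (torus_pi (x, y))]); last first.
  by apply/seteqP; split=> y /= => [[]|].
rewrite -[RHS](@lebesgue_measure_periodic (s x)).
- congr (mu (_ `&` _)); apply/seteqP; split=> y /=;
    rewrite (_ : f (torus_pi (x, y)) = torus_pi (vshear s (x, y)))//;
    by [move=> []|have := congr1 (fun h => h (x, y)) sf].
- exact: section_measurable.
- move=> y k ik /=; rewrite (_ : (x, y + k) = (x, y) + (0, k)).
    by rewrite torus_piD// /integral_vec/= rpred0.
  by apply: plane_eq => //=; rewrite addr0.
Qed.

Definition swap (u : plane R) : plane R := (u.2, u.1).

(** Exchanges the order of integration: the two iterated integrals agree by uniqueness of the
    product measure. Horizontal shears are conjugates of vertical ones by [swap]. *)
Lemma swap_preserves_leb (f : torus R -> torus R) :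
  torus_pi \o swap = f \o torus_pi -> preserves_leb f.
Proof.
move=> sf A mA.
pose X := torus_pi @^-1` A `&` (`[0, 1[ `*` `[0, 1[).
have mX : measurable (X : set (measurableTypeR R * measurableTypeR R)).
  apply: measurableI; last by apply: measurableX; exact: measurable_itv.
  by rewrite -[X in measurable X]setTI; exact: torus_pi_measurable.
have -> : tleb A = (mu \x^ mu)%E X.
  rewrite /torus_leb /pushforward /mrestr -/X.
  by apply: product_measure_unique => // B C mB mC/=; rewrite product_measure2E.
rewrite torus_lebE /product_measure2; apply: eq_integral => x _.
congr (mu _); apply/seteqP; split=> y; rewrite /ysection/= inE/= /X/=;
  rewrite (_ : f (torus_pi (x, y)) = torus_pi (y, x)) //;
  try by have := congr1 (fun h => h (x, y)) sf.
  by move=> [[? ?] ?]; do !split.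
by move=> [? []].
Qed.

End shear_measure.

(** * Bounded periodic interpolation *)

Section interpolation.
Context {R : realType}.

Definition int_periodic (s : R -> R) :=
  forall x k : R, k \is a Num.int -> s (x + k) = s x.

(** A continuous substitute for the distance to the nearest integer: periodic, nonnegative, zero
    exactly at the integers. *)
Definition circle_gap (x : R) : R := sin (pi * x) ^+ 2.

Lemma circle_gap_continuous : continuous circle_gap.
Proof.
have cs : continuous (fun x : R => sin (pi * x)).
  move=> x; apply: (@continuous_comp _ _ _ (fun x : R => pi * x) sin).
    by apply: cvgM; [exact: cvg_cst|exact: cvg_id].
  exact: continuous_sin.
by move=> x; rewrite /circle_gap; apply: cvgM; exact: cs.
Qed.

Lemma circle_gap_periodic : int_periodic circle_gap.
Proof.
have step x : circle_gap (x + 1) = circle_gap x.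
  by rewrite /circle_gap mulrDr mulr1 sinDpi sqrrN.
have nat_step x (n : nat) : circle_gap (x + n%:R) = circle_gap x.
  elim: n => [|n IH]; first by rewrite addr0.
  by rewrite -addn1 natrD addrA step.
move=> x k /intrP[[n|n] ->]; first exact: nat_step.
by rewrite NegzE -[LHS](nat_step _ n.+1) rmorphN/= -pmulrn subrK.
Qed.

Lemma circle_gap_ge0 x : 0 <= circle_gap x. Proof. exact: sqr_ge0. Qed.

Lemma circle_gap_eq0 x : (circle_gap x == 0) = (x \is a Num.int).
Proof.
apply/idP/idP => [|xi]; last first.
  by rewrite -[x]add0r circle_gap_periodic// /circle_gap mulr0 sin0 expr0n.
apply: contraTT => xi; have /andP[f0 f1] := frac_itv x.
rewrite -(circle_gap_periodic x (frac_int x)) subrKC.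
have f00 : 0 < frac x.
  rewrite lt_neqAle f0 andbT eq_sym; apply: contra xi => /eqP fx.
  by have := frac_int x; rewrite fx sub0r rpredN.
rewrite sqrf_eq0 gt_eqF// sin_gt0_pi// mulr_gt0 ?pi_gt0//=.
by rewrite gtr_pMr ?pi_gt0.
Qed.

(** Nodes are added one at a time. The new function is a convex combination of the old one and the
    constant [r a], whose weight [q / m] is 1 at [a] and 0 at the earlier nodes; convexity preserves
    the bound [B]. *)
Lemma interpolate (r : R -> R) (B : R) (xs : seq R) :
  int_periodic r -> (forall x, `|r x| <= B) ->
  exists s, [/\ continuous s, int_periodic s, forall x, `|s x| <= B &
    forall x, x \in xs -> s x = r x].
Proof.
move=> pr rB; have B0 : 0 <= B by exact: le_trans (rB 0).
elim: xs => [|a xs [s [cs ps sB sr]]].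
  by exists (fun=> 0); split => // [x|x]; [exact: cvg_cst|rewrite normr0].
have [/hasP[b bxs ba]|/hasPn axs] := boolP (has (fun b => a - b \is a Num.int) xs).
  exists s; split => // x; rewrite inE => /orP[/eqP ->|/sr//].
  by rewrite -(subrKC b a) (ps _ _ ba) (pr _ _ ba) sr.
pose q x := \prod_(b <- xs) circle_gap (x - b).
have cgap b : continuous (fun x => circle_gap (x - b)).
  move=> x; apply: (@continuous_comp _ _ _ (fun x : R => x - b) circle_gap).
    by apply: cvgB; [exact: cvg_id|exact: cvg_cst].
  exact: circle_gap_continuous.
have cq : continuous q.
  rewrite /q; elim: (xs) => [|b ys IH] x.
    have -> : (fun x => \prod_(b <- [::]) circle_gap (x - b)) = fun=> 1.
      by apply/funext => y; rewrite big_nil.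
    exact: cvg_cst.
  have -> : (fun x => \prod_(b <- b :: ys) circle_gap (x - b)) =
      (fun x => circle_gap (x - b) * \prod_(b <- ys) circle_gap (x - b)).
    by apply/funext => y; rewrite big_cons.
  by apply: cvgM; [exact: cgap|exact: IH].
have q0 x : 0 <= q x by apply: prodr_ge0 => b _; exact: circle_gap_ge0.
have pgap b : int_periodic (fun x => circle_gap (x - b)).
  by move=> x k ik; rewrite (addrAC x k) (circle_gap_periodic _ ik).
have pq : int_periodic q.
  by move=> x k ik; rewrite /q; apply: eq_bigr => b _; exact: pgap.
pose m x := q x + circle_gap (x - a).
(* A common zero of the two terms would make [a] congruent mod 1 to an earlier node [b], the case
   already settled. *)
have m0 x : 0 < m x.
  rewrite /m lt_neqAle addr_ge0 ?circle_gap_ge0// andbT eq_sym.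
  rewrite paddr_eq0 ?circle_gap_ge0//; apply/negP => /andP[qx xa].
  move: qx; rewrite /q prodf_seq_eq0 => /hasP[b bxs /= xb].
  have /negP := axs b bxs; apply; rewrite -opprB rpredN.
  rewrite (_ : b - a = (x - a) - (x - b)); last by ring.
  by rewrite rpredB// -circle_gap_eq0.
exists (fun x => s x + (r a - s x) * (q x / m x)); split.
- move=> x; apply: cvgD; first exact: cs.
  apply: cvgM; first by apply: cvgB; [exact: cvg_cst|exact: cs].
  apply: cvgM; first exact: cq.
  by apply: cvgV; [rewrite gt_eqF|apply: cvgD; [exact: cq|exact: cgap]].
- by move=> x k ik; rewrite /m ps// pq// pgap.
- move=> x; have -> : s x + (r a - s x) * (q x / m x) =
      s x * (circle_gap (x - a) / m x) + r a * (q x / m x).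
    rewrite [circle_gap _](_ : _ = m x - q x); last by rewrite /m; ring.
    by field; rewrite gt_eqF.
  have -> : B = B * (circle_gap (x - a) / m x) + B * (q x / m x).
    rewrite -mulrDr -mulrDl [circle_gap _ + _]addrC -/(m x).
    by rewrite divff ?mulr1// gt_eqF.
  have g0 : 0 <= circle_gap (x - a) / m x.
    by rewrite divr_ge0 ?circle_gap_ge0// ltW.
  have qm0 : 0 <= q x / m x by rewrite divr_ge0// ltW.
  rewrite (le_trans (ler_normD _ _))// (normrM (s x)) (normrM (r a)).
  by rewrite (ger0_norm g0) (ger0_norm qm0) lerD// ler_wpM2r.
- move=> x; rewrite inE => /orP[/eqP ->|xxs].
    have gaa : circle_gap (a - a) = 0 by rewrite subrr; apply/eqP; rewrite circle_gap_eq0 rpred0.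
    have ma : m a = q a by rewrite /m gaa addr0.
    by rewrite ma divff ?mulr1 ?subrKC// -ma gt_eqF.
  have -> : q x = 0.
    apply/eqP; rewrite /q prodf_seq_eq0; apply/hasP; exists x => //=.
    by rewrite subrr circle_gap_eq0 rpred0.
  by rewrite mul0r mulr0 addr0 sr.
Qed.

Lemma interpolate_family (I : finType) (b d : I -> R) (B : R) :
  0 <= B -> (forall i, `|d i| <= B) ->
  (forall i j, b i - b j \is a Num.int -> i = j) ->
  exists s, [/\ continuous s, int_periodic s, forall x, `|s x| <= B &
    forall i, s (b i) = d i].
Proof.
move=> B0 dB bi.
(* The values [d] are extended to a periodic function, 0 off the nodes; distinctness of the nodes
   mod 1 makes the picked index the right one. *)
pose r x := if [pick i | x - b i \is a Num.int] is Some i then d i else 0.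
have [x k ik|x|s [cs ps sB sr]] := @interpolate r B (map b (enum I)).
- rewrite /r; congr (if _ is Some _ then _ else _); apply: eq_pick => i.
  by rewrite addrAC rpredDr.
- by rewrite /r; case: pickP => [i _|_]; rewrite ?normr0.
exists s; split => // i; rewrite sr ?map_f ?mem_enum// /r.
case: pickP => [j /bi -> //|/(_ i)].
by rewrite subrr rpred0.
Qed.

End interpolation.

(** * Moving finitely many points by shears *)

Section shears.
Context {R : realType}.
Implicit Types (u v w k : plane R) (s : R -> R).

Lemma descend (F : plane R -> plane R) : continuous F ->
  (forall u v, torus_pi u = torus_pi v -> torus_pi (F u) = torus_pi (F v)) ->
  exists f, is_lift f F.
Proof.
move=> cF Fpi; exists (fun x => torus_pi (F (repr x))); split => //.
by apply/funext => u /=; apply: Fpi; rewrite [in RHS]/torus_pi reprK.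
Qed.

Lemma vshear_continuous s : continuous s -> continuous (vshear s).
Proof.
move=> cs; apply: continuous_pair => u; first exact: cvg_fst.
apply: cvgD; first exact: cvg_snd.
by apply: (@continuous_comp _ _ _ fst s); [exact: cvg_fst|exact: cs].
Qed.

Lemma vshear_equivariant s : int_periodic s -> equivariant (vshear s).
Proof.
move=> ps u k /andP[k1 k2]; apply: plane_eq => //=.
by rewrite ps// addrAC.
Qed.

Lemma swap_continuous : continuous (@swap R).
Proof. by apply: continuous_pair => u; [exact: cvg_snd|exact: cvg_fst]. Qed.

Lemma vshearK s : cancel (vshear s) (vshear (fun x => - s x)).
Proof. by move=> u; apply: plane_eq => //=; rewrite addrK. Qed.

Lemma vshearNK s : cancel (vshear (fun x => - s x)) (vshear s).
Proof. by move=> u; apply: plane_eq => //=; rewrite subrK. Qed.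

Lemma lift_can (f g : torus R -> torus R) F G :
  is_lift f F -> is_lift g G -> cancel F G -> cancel f g.
Proof.
move=> fF gG FG x; have [u <-] := torus_pi_surj x.
by rewrite -(is_liftE _ fF) -(is_liftE _ gG) FG.
Qed.

Lemma vshear_homeo s : continuous s -> int_periodic s ->
  exists f : homeo_leb R, is_lift f (vshear s).
Proof.
move=> cs ps.
have cNs : continuous (fun x => - s x).
  by move=> x; apply: cvgN; exact: cs.
have pNs : int_periodic (fun x => - s x) by move=> x k ik; rewrite ps.
have [f fF] := descend (vshear_continuous cs)
  (fun u v => equivariant_pi (vshear_equivariant ps)).
have [g gG] := descend (vshear_continuous cNs)
  (fun u v => equivariant_pi (vshear_equivariant pNs)).
have [h hf] := homeo_leb_build fF (vshear_equivariant ps) gG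
  (lift_can fF gG (vshearK s)) (lift_can gG fF (vshearNK s))
  (vshear_preserves_leb fF.2).
by exists h; rewrite hf.
Qed.

Definition hshear s : plane R -> plane R := swap \o vshear s \o swap.

Lemma hshear_equivariant s : int_periodic s -> equivariant (hshear s).
Proof.
move=> ps u k /andP[k1 k2]; apply: plane_eq => //=.
by rewrite ps// addrAC.
Qed.

Lemma hshear_homeo s : continuous s -> int_periodic s ->
  exists f : homeo_leb R, is_lift f (hshear s).
Proof.
move=> cs ps.
have [sw swP] : exists f, is_lift f (@swap R).
  apply: descend; first exact: swap_continuous.
  by move=> u v /torus_piP /andP[? ?]; apply/torus_piP/andP.
have cNs : continuous (fun x => - s x).
  by move=> x; apply: cvgN; exact: cs.
have pNs : int_periodic (fun x => - s x) by move=> x k ik; rewrite ps.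
have [f fF] := vshear_homeo cs ps; have [g gG] := vshear_homeo cNs pNs.
have fP := is_lift_comp swP (is_lift_comp fF swP).
have gP := is_lift_comp swP (is_lift_comp gG swP).
have [|||h hf] := homeo_leb_build fP (hshear_equivariant ps) gP.
- apply: (lift_can fP gP) => u /=.
  by apply: plane_eq => //=; rewrite addrK.
- apply: (lift_can gP fP) => u /=.
  by apply: plane_eq => //=; rewrite subrK.
- apply: preserves_leb_comp; [exact: lift_continuous swP|..].
    exact: swap_preserves_leb swP.2.
  apply: preserves_leb_comp; [exact: homeo_leb_cont|..].
    by case: (homeo_lebE f).
  exact: swap_preserves_leb swP.2.
by exists h; rewrite hf; exact: fP.
Qed.

Lemma edist_vshear s u : edist (vshear s u) u = `|s u.1|.
Proof. by rewrite /edist/= subrr expr0n add0r addrAC subrr add0r sqrtr_sqr. Qed.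

Lemma edist_hshear s u : edist (hshear s u) u = `|s u.2|.
Proof.
by rewrite /edist/= subrr expr0n addr0 addrAC subrr add0r sqrtr_sqr.
Qed.

(** If [D] is an integer, a nonzero [c * T] of absolute value below 1 cannot lead to another one;
    otherwise [c * T] is kept below the distance from [D] to the integers. *)
Lemma int_avoid (D T : R) : `|T| <= 2 -> (D \is a Num.int -> T != 0) ->
  \forall c \near (0 : R)^'+, (D + c * T) \isn't a Num.int.
Proof.
move=> T2 DT.
have [d d0 dP] : exists2 d, 0 < d & forall c, 0 < c -> c * 2 < d ->
    (D + c * T) \isn't a Num.int.
  have not01 (r : R) : 0 < `|r| < 1 -> r \isn't a Num.int.
    move=> /andP[r0 r1]; apply/negP => /norm_intr_ge1.
    by rewrite -normr_gt0 => /(_ r0); rewrite leNgt r1.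
  have cT c : 0 < c -> `|c * T| <= c * 2.
    by move=> c0; rewrite normrM (gtr0_norm c0) ler_pM2l.
  have [Di|Di] := boolP (D \is a Num.int).
    exists 1 => // c c0 c1; rewrite rpredDl//; apply: not01.
    rewrite (le_lt_trans (cT c c0) c1) andbT normr_gt0 mulf_neq0 ?DT//.
    by rewrite gt_eqF.
  have /andP[f0 f1] := frac_itv D.
  have f00 : 0 < frac D.
    rewrite lt_neqAle f0 andbT eq_sym; apply: contra Di => /eqP fx.
    by have := frac_int D; rewrite fx sub0r rpredN.
  exists (Num.min (frac D) (1 - frac D)); first by rewrite lt_min f00 subr_gt0.
  move=> c c0; rewrite lt_min => /andP[c1 c2].
  rewrite -(rpredDr _ (frac_int D)) (_ : D + c * T + (frac D - D) = frac D + c * T); last by ring.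
  have := cT c c0; rewrite ler_norml => /andP[l1 l2].
  by apply: not01; rewrite gtr0_norm; [apply/andP; split|]; lra.
near=> c; apply: dP; near: c; first exact: nbhs_right_gt.
near=> c; rewrite -ltr_pdivlMr//; near: c.
by apply: nbhs_right_lt; rewrite divr_gt0.
Unshelve. all: by end_near. Qed.

(* Shears with arbitrarily small amplitude [c] make second coordinates distinct
   mod 1: only small positive values of [c] have to be avoided. *)
Lemma separating_shear (I : finType) (u : I -> plane R) (d : R) : 0 < d ->
  (forall i j, torus_pi (u i) = torus_pi (u j) -> i = j) ->
  exists s, [/\ continuous s, int_periodic s, forall x, `|s x| <= d &
    forall i j, (vshear s (u i)).2 - (vshear s (u j)).2 \is a Num.int -> i = j].
Proof.
move=> d0 uinj.
have pfrac : int_periodic (@frac R).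
  by move=> x k ik; rewrite (@frac_diff _ (x + k) x)// addrAC subrr add0r.
have frac1 (x : R) : `|frac x| <= 1.
  by have /andP[? ?] := frac_itv x; rewrite ger0_norm// ltW.
(* At the points, [t] takes the same value only for first coordinates equal mod 1. So when two
   second coordinates already agree mod 1, injectivity of [u] makes the values of [t] differ, which
   is the condition on [T] in [int_avoid]. *)
have [t [ct pt t1 tE]] :=
  interpolate (map (fun i => (u i).1) (enum I)) pfrac frac1.
have {}tE i : t (u i).1 = frac (u i).1 by rewrite tE// (map_f (fun i => (u i).1)) ?mem_enum.
have : \forall c \near (0 : R)^'+, forall p : I * I, p.1 != p.2 ->
    ((u p.1).2 - (u p.2).2) + c * (t (u p.1).1 - t (u p.2).1) \isn't a Num.int.
  apply: filter_forall => -[i j]; have [<-|ij] := eqVneq i j.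
    by near=> c => /= /eqP.
  suff H : \forall c \near (0 : R)^'+,
      ((u i).2 - (u j).2) + c * (t (u i).1 - t (u j).1) \isn't a Num.int.
    by apply: filterS H => c ? _.
  apply: int_avoid.
    rewrite (le_trans (ler_normB _ _))// (_ : 2 = 1 + 1)// lerD//.
  move=> D2; rewrite !tE subr_eq0.
  apply: contra ij => /eqP fij; apply/eqP/uinj/torus_piP/andP; split => //=.
  have := rpredB (frac_int (u j).1) (frac_int (u i).1); rewrite fij.
  by rewrite (_ : _ - _ - _ = (u i).1 - (u j).1)//; ring.
move=> H.
have [c [[c0 cd] cP]] : exists c, (0 < c /\ c < d) /\ forall p : I * I, p.1 != p.2 ->
    ((u p.1).2 - (u p.2).2) + c * (t (u p.1).1 - t (u p.2).1) \isn't a Num.int.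
  apply: (@filter_ex _ (0 : R)^'+); near=> c; split; last by near: c.
  by split; near: c; [exact: nbhs_right_gt|exact: nbhs_right_lt].
exists (fun x => c * t x); split.
- by move=> x; apply: cvgM; [exact: cvg_cst|exact: ct].
- by move=> x k ik; rewrite pt.
- move=> x; rewrite normrM (gtr0_norm c0) (le_trans _ (ltW cd))//.
  by rewrite ler_piMr// ltW.
- move=> i j /= ij; apply/eqP; apply: contraT => /(cP (i, j))/negP; case => /=.
  by rewrite (_ : _ + _ = (u i).2 + c * t (u i).1 - ((u j).2 + c * t (u j).1))//; ring.
Unshelve. all: by end_near. Qed.

(* The first shear makes the second coordinates of the sources distinct; the
   next two adjust the first, then the second coordinates, up to a shear making
   the first coordinates of the targets distinct, which the last one undoes. *)
Lemma move_points (I : finType) (u w : I -> plane R) (e : R) : 0 < e ->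
  (forall i, edist (u i) (w i) <= e) ->
  (forall i j, torus_pi (u i) = torus_pi (u j) -> i = j) ->
  (forall i j, torus_pi (w i) = torus_pi (w j) -> i = j) ->
  exists (f : homeo_leb R) (F : plane R -> plane R), [/\ is_lift f F,
    forall v, edist (F v) v <= 6 * e & forall i, F (u i) = w i].
Proof.
move=> e0 uw uinj winj.
have [s0 [cs0 ps0 s0e s0i]] := separating_shear e0 uinj.
(* [separating_shear] acts on second coordinates, whereas the first coordinates of the targets have
   to be separated. *)
have swinj i j : torus_pi (swap (w i)) = torus_pi (swap (w j)) -> i = j.
  by move=> /torus_piP /andP[? ?]; apply/winj/torus_piP/andP.
have [s3 [cs3 ps3 s3e s3i]] := separating_shear e0 swinj.
pose u' i := vshear s0 (u i); pose w' i := hshear s3 (w i).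
have d1 i : `|(w' i).1 - (u' i).1| <= 2 * e.
  rewrite /u'/= (_ : _ - _ = ((w i).1 - (u i).1) + s3 (w i).2); last by ring.
  rewrite (le_trans (ler_normD _ _))//.
  have := edist_fst (u i) (w i); rewrite distrC.
  by have := s3e (w i).2; have := uw i; lra.
have d2 i : `|(w' i).2 - (u' i).2| <= 2 * e.
  rewrite /u'/= (_ : _ - _ = ((w i).2 - (u i).2) - s0 (u i).1); last by ring.
  rewrite (le_trans (ler_normB _ _))//.
  have := edist_snd (u i) (w i); rewrite distrC.
  by have := s0e (u i).1; have := uw i; lra.
have e20 : 0 <= 2 * e by lra.
have [s1 [cs1 ps1 s1e s1E]] := interpolate_family e20 d1 s0i.
have [s2 [cs2 ps2 s2e s2E]] := interpolate_family e20 d2 s3i.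
have cNs3 : continuous (fun x => - s3 x).
  by move=> x; apply: cvgN; exact: cs3.
have pNs3 : int_periodic (fun x => - s3 x) by move=> x k ik; rewrite ps3.
have [f0 fF0] := vshear_homeo cs0 ps0.
have [f1 fF1] := hshear_homeo cs1 ps1.
have [f2 fF2] := vshear_homeo cs2 ps2.
have [f3 fF3] := hshear_homeo cNs3 pNs3.
have [f10 f10E] := homeo_leb_comp f1 f0.
have [f210 f210E] := homeo_leb_comp f2 f10.
have [f fE] := homeo_leb_comp f3 f210.
exists f, (hshear (fun x => - s3 x) \o (vshear s2 \o (hshear s1 \o vshear s0))).
split.
- rewrite fE f210E f10E.
  exact: is_lift_comp fF3 (is_lift_comp fF2 (is_lift_comp fF1 fF0)).
(* The amplitudes of the four shears are [e], [2 * e], [2 * e] and [e]. *)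
- move=> v /=; set v0 := vshear s0 v; set v1 := hshear s1 v0.
  set v2 := vshear s2 v1.
  have := edist_triangle v0 v1 v; have := edist_triangle v1 v2 v.
  have := edist_triangle v2 (hshear (fun x => - s3 x) v2) v.
  rewrite !edist_vshear !edist_hshear normrN.
  have := s0e v.1; have := s1e v0.2; have := s2e v1.1; have := s3e v2.2.
  lra.
- move=> i /=.
  have -> : hshear s1 (vshear s0 (u i)) = ((w' i).1, (u' i).2).
    by apply: plane_eq => //=; rewrite s1E subrKC.
  have -> : vshear s2 ((w' i).1, (u' i).2) = w' i.
    by apply: plane_eq => //=; rewrite s2E subrKC.
  by apply: plane_eq => //=; rewrite addrK.
Qed.

End shears.

(** * Chain transitivity *)

Section chains.
Context {R : realType}.
Implicit Types (x y z : torus R) (u v : plane R) (V : set (torus R)).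

Lemma torus_leb_open_gt0 (U : set (torus R)) x :
  open U -> U x -> (0 < torus_leb U)%E.
Proof.
move=> oU; have [u0 <-] := torus_pi_surj x.
rewrite -frac_vec_pi; set u := frac_vec u0 => Uu.
have /andP[u1 u1'] := frac_itv u0.1; have /andP[u2 u2'] := frac_itv u0.2.
have oP : open (torus_pi @^-1` U).
  by apply: open_comp => // v _; exact: torus_pi_continuous.
have /nbhs_ballP[e /= e0 eU] : nbhs u (torus_pi @^-1` U).
  by apply: open_nbhs_nbhs.
(* The half-open box of side [d] with lower left corner [u] stays both in the preimage of [U] and in
   the fundamental domain. *)
pose d := Num.min e (Num.min (1 - u.1) (1 - u.2)).
have d0 : 0 < d by rewrite !lt_min e0 !subr_gt0 u1' u2'.
have [de [d1 d2]] : d <= e /\ d <= 1 - u.1 /\ d <= 1 - u.2.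
  by rewrite /d !ge_min !lexx !orbT.
rewrite /torus_leb /pushforward /mrestr.
have mB (a : R) : measurable (`[a, a + d[%classic : set (measurableTypeR R)).
  exact: measurable_itv.
apply: (@lt_le_trans _ _ ((lebesgue_measure \x lebesgue_measure)%E
  (`[u.1, u.1 + d[ `*` `[u.2, u.2 + d[))).
  rewrite product_measure1E// [X in (_ < X * _)%E]lebesgue_measure_itv.
  rewrite [X in (_ < _ * X)%E]lebesgue_measure_itv/= !lte_fin !ltrDl d0.
  by rewrite -!EFinD -EFinM lte_fin mulr_gt0//= addrAC subrr add0r.
apply: le_measure.
- by rewrite inE; exact: measurableX.
- rewrite inE; apply: measurableI; last first.
    by apply: measurableX; exact: measurable_itv.
  exact: open_plane_measurable.
- move=> v [/=]; rewrite !in_itv/= => /andP[v1 v1'] /andP[v2 v2']; split.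
    apply: eU; split => /=.
      by rewrite /ball/= distrC ger0_norm ?subr_ge0//; lra.
    by rewrite /ball/= distrC ger0_norm ?subr_ge0//; lra.
  split; apply/andP; split.
  + exact: le_trans u1 v1.
  + by rewrite (lt_le_trans v1')// -lerBrDl.
  + exact: le_trans u2 v2.
  + by rewrite (lt_le_trans v2')// -lerBrDl.
Qed.

Section reach.
Variable f : torus R -> torus R.

(* An [e]-chain from [x] to [y] with [n] intermediate points, all in [V]. *)
Fixpoint reach V (e : R) (n : nat) x y : Prop :=
  if n is n'.+1 then exists z, [/\ V z, tdist (f x) z < e & reach V e n' z y]
  else tdist (f x) y < e.

Lemma reach_rcons V e n x y z :
  reach V e n x y -> V y -> tdist (f y) z < e -> reach V e n.+1 x z.
Proof.
move=> + Vy yz; elim: n x => [x xy|n IH x [t [Vt xt ty]]]; first by exists y.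
by exists t; split => //; exact: IH.
Qed.

Lemma reach_open V e n x y : reach V e n x y ->
  exists2 d, 0 < d & forall z, tdist y z < d -> reach V e n x z.
Proof.
elim: n x => [x xy|n IH x [t [Vt xt /IH[d d0 dP]]]].
  exists (e - tdist (f x) y); first by rewrite subr_gt0.
  by move=> z yz; have := tdist_trans y (f x) z => /=; lra.
by exists d => // z /dP tz; exists t.
Qed.

Lemma reach_le V e e' n x y : e <= e' -> reach V e n x y -> reach V e' n x y.
Proof.
move=> ee'; elim: n x => [x /=|n IH x [z [Vz xz /IH zy]]].
  by move=> /lt_le_trans; exact.
by exists z; split => //; exact: lt_le_trans ee'.
Qed.

(** Moves a chain into a [d]-dense set [V]. A jump grows to its own [e], plus [e] from applying [f]
    to a moved point, plus [d] from moving its target. *)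
Lemma reach_perturb V e d n x y x' y' :
  0 < d -> (forall z, exists2 z', V z' & tdist z z' < d) ->
  (forall z z', tdist z z' < d -> tdist (f z) (f z') < e) ->
  tdist x x' < d -> tdist y y' < d ->
  reach setT e n x y -> reach V (2 * e + d) n x' y'.
Proof.
move=> d0 Vd fd; elim: n x x' => [x x' xx' yy' /= xy|n IH x x' xx' yy'].
  have := fd _ _ xx'; have := tdist_trans (f x) (f x') y'.
  by have := tdist_trans y (f x) y'; rewrite (tdist_sym (f x') (f x)); lra.
move=> [z [_ xz zy]]; have [z' Vz' zz'] := Vd z.
exists z'; split => //; last exact: (IH z).
have := fd _ _ xx'; have := tdist_trans (f x) (f x') z'.
by have := tdist_trans z (f x) z'; rewrite (tdist_sym (f x') (f x)); lra.
Qed.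

Lemma reach_lift V e n F u y : is_lift f F -> reach V e n (torus_pi u) y ->
  exists c : nat -> plane R, [/\ c 0%N = u, torus_pi (c n.+1) = y &
    forall j, (j <= n)%N -> edist (F (c j)) (c j.+1) < e].
Proof.
move=> fF; elim: n u => [u /=|n IH u [z [Vz uz zy]]].
  rewrite -(is_liftE _ fF) => /tdist_ltP[v vy uv].
  exists (fun j => if j is 0%N then u else v); split => //.
  by move=> [|j].
move: uz; rewrite -(is_liftE _ fF) => /tdist_ltP[v vz uv].
have [|c [c0 cn cP]] := IH v; first by rewrite vz.
exists (fun j => if j is j'.+1 then c j' else u); split => //.
move=> [_|j jn]; first by rewrite c0.
exact: cP.
Qed.

End reach.

(* The set [C] of points reachable from [x] is open and [f @` C `<=` C] has the
   same measure as [C], hence is dense in it; as [C] contains the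
   [e]-neighbourhood of [f @` C], it is also closed. *)
Lemma chain_transitive (f : homeo_leb R) (e : R) x y :
  0 < e -> exists n, reach f setT e n x y.
Proof.
move=> e0.
have [cf [g [cg fg gf]] _ pf] := homeo_lebE f.
pose C := [set z | exists n, reach f setT e n x z].
have oC : open C.
  move=> z [n /reach_open[d d0 dP]]; apply/torus_nbhsP.
  by exists d => // t /dP; exists n.
have fC z : C z -> C (f z).
  move=> [n nz]; exists n.+1; apply: (reach_rcons nz) => //.
  by rewrite tdistxx.
pose D := g @^-1` C.
have oD : open D by apply: open_comp => // z _; exact: cg.
have DC : D `<=` C by move=> z /= /fC; rewrite gf.
have CD : C `<=` closure D.
  apply: contrapT => /existsNP[z /not_implyP[Cz nDz]].
  pose E := C `&` ~` closure D.
  have oE : open E.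
    by apply: openI => //; apply: closed_openC; exact: closed_closure.
  have Epos : (0 < torus_leb E)%E by apply: (@torus_leb_open_gt0 E z).
  have mopen (A : set (torus R)) : open A -> measurable A.
    exact: sub_sigma_algebra.
  have fD : torus_leb D = torus_leb C.
    rewrite -pf; last exact: mopen.
    by congr torus_leb; apply/seteqP; split=> t; rewrite /D/= fg.
  have mpi (A : set (torus R)) : measurable A -> measurable (torus_pi @^-1` A).
    by move=> mA; rewrite -[X in measurable X]setTI; exact: torus_pi_measurable.
  have leC : (torus_leb D + torus_leb E <= torus_leb C)%E.
    rewrite /torus_leb /pushforward -measureU.
    + apply: le_measure; rewrite ?inE.
      * by apply: measurableU; apply: mpi; exact: mopen.
      * by apply: mpi; exact: mopen.
      * by move=> u [/DC|[]].
    + by apply: mpi; exact: mopen.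
    + by apply: mpi; exact: mopen.
    + by apply/seteqP; split=> // u [/= /subset_closure Du [_]]; exact.
  have Cfin : torus_leb C \is a fin_num.
    rewrite ge0_fin_numE; last exact: (measure_ge0 (mrestr _ _)).
    apply: (@le_lt_trans _ _ 1%E); last exact: ltry.
    rewrite -(@torus_leb_setT R) /torus_leb /pushforward.
    apply: le_measure => //; rewrite inE; apply: mpi => //; exact: mopen.
  move: leC; rewrite fD -leeBrDl// subee// leNgt.
  by rewrite Epos.
suff : C y by [].
apply: (@torus_clopen _ C (f x)) => //; last first.
  by exists 0%N; rewrite /= tdistxx.
move=> z /(closure_subset CD); rewrite -(closure_id _).1; last exact: closed_closure.
move=> /(_ [set t | tdist z t < e]) [].
  by apply/torus_nbhsP; exists e.
move=> t [/= [n nt] zt]; exists n.+1; apply: (reach_rcons nt) => //.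
by rewrite gf tdist_sym.
Qed.

(** Compactness of the set of pairs of endpoints. The uniform length makes the cost of closing a
    long orbit negligible in [closed_chain]. *)
Lemma chain_bounded (f : homeo_leb R) (e : R) : 0 < e ->
  exists L, forall x y, exists2 n, (n <= L)%N & reach f setT e n x y.
Proof.
move=> e0; have e30 : 0 < e / 3 by rewrite divr_gt0.
have [d0 d00 fd0] := torus_ucont (@homeo_leb_cont R f) e30.
pose d := Num.min d0 (e / 3).
have dd : 0 < d by rewrite lt_min d00.
have fd x x' : tdist x x' < d -> tdist (f x) (f x') < e / 3.
  by rewrite lt_min => /andP[/fd0].
(* [compact_uniform] yields a positive real, so the bound on the length is encoded as the inverse of
   [r]. *)
pose P (r : R) (p : torus R * torus R) := 0 < r ->
  exists2 n, n%:R <= r^-1 & reach f setT e n p.1 p.2.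
have [r r0 rP] : exists2 r, 0 < r & forall p, setT p -> P r p.
  apply: compact_uniform.
  - by rewrite -setXTT; apply: compact_setX; exact: torus_compact.
  - move=> r r' p r'r Pr r'0.
    have r0 : 0 < r by exact: lt_le_trans r'r.
    have [n nr pn] := Pr r0; exists n => //.
    by rewrite (le_trans nr)// lef_pV2 ?posrE.
  - move=> [x y] _; have [n xy] := chain_transitive f x y e30.
    exists n.+1%:R^-1; first by rewrite invr_gt0.
    apply/nbhs_ballP; exists d => // -[x' y'] [/=].
    rewrite !ballEmdist => xx' yy' _ _; exists n.
      by rewrite invrK ler_nat.
    apply: (@reach_le _ _ (2 * (e / 3) + d)).
      by have : d <= e / 3 by [rewrite ge_min lexx orbT]; lra.
    apply: reach_perturb xy => // z; exists z => //.
    by rewrite tdistxx.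
exists (Num.truncn r^-1).+1 => x y.
have [n nr xy] := rP (x, y) I r0; exists n => //.
by rewrite ltnW// -(@ltr_nat R) (le_lt_trans nr)// truncnS_gt.
Qed.

End chains.

(** * Closed chains approximating rotation vectors *)

Section closed_chains.
Context {R : realType}.
Implicit Types (u v w k : plane R) (F : plane R -> plane R).

Definition enorm u : R := edist u 0.

Lemma edist_enorm u v : edist u v = enorm (u - v).
Proof. by rewrite /enorm -(edistD2r (- v)) subrr. Qed.

Lemma enormD u v : enorm (u + v) <= enorm u + enorm v.
Proof.
rewrite (le_trans (edist_triangle v _ _))// lerD2r.
by rewrite edist_enorm addrK.
Qed.

Lemma enormN u : enorm (- u) = enorm u.
Proof. by rewrite /enorm -(edistD2r u) addNr add0r edistC. Qed.

Lemma enormZ (a : R) u : enorm (a *: u) = `|a| * enorm u.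
Proof.
rewrite /enorm /edist /= !subr0 !exprMn -mulrDr sqrtrM ?sqr_ge0//.
by rewrite sqrtr_sqr.
Qed.

Lemma enorm_ge0 u : 0 <= enorm u. Proof. exact: edist_ge0. Qed.

Lemma rotation_setP F v : rotation_set F v <-> forall (M : nat) (e : R), 0 < e ->
  exists m u, [/\ (M <= m)%N, (0 < m)%N &
    edist (m%:R^-1 *: (iter m F u - u)) v < e].
Proof.
split=> [Fv M e e0|Fv M /= M0].
  have /(_ isT [set w | edist v w < e]) [|w [[m /= Mm [u _ <-]] vw]] := Fv M.+1.
    by apply/plane_nbhsP; exists e.
  exists m, u; split; [exact: ltnW|exact: leq_ltn_trans Mm|].
  by rewrite edistC.
move=> A /plane_nbhsP[e e0 eA].
have [m [u [Mm m0 muv]]] := Fv M e e0.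
exists (m%:R^-1 *: (iter m F u - u)); split; last by apply: eA; rewrite edistC.
by exists m => //; exists u.
Qed.

Lemma chain_displacement F (D e : R) (c : nat -> plane R) n :
  (forall u, edist (F u) u <= D) ->
  (forall j, (j < n)%N -> edist (F (c j)) (c j.+1) < e) ->
  edist (c n) (c 0%N) <= n%:R * (D + e).
Proof.
move=> FD; elim: n => [_|n IH ce]; first by rewrite edistxx mul0r.
have /IH {}IH : forall j, (j < n)%N -> edist (F (c j)) (c j.+1) < e.
  by move=> j jn; apply: ce; exact: ltnW.
have := edist_triangle (c n) (c n.+1) (c 0%N).
have := edist_triangle (F (c n)) (c n.+1) (c n).
have := ce n (ltnSn n); have := FD (c n).
rewrite (edistC (c n.+1) (F (c n))) -addn1 natrD mulrDl mul1r; lra.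
Qed.

(** A long orbit segment with average displacement close to [v] is closed by a chain of bounded
    length. Its ends then project to one point, so the total displacement [k] is integral. *)
Lemma closed_chain (f : homeo_leb R) F v (e : R) :
  is_lift f F -> rotation_set F v -> 0 < e ->
  exists (p : nat) (c : nat -> plane R) k, [/\ (0 < p)%N, integral_vec k,
    c p = c 0%N + k, forall j, (j < p)%N -> edist (F (c j)) (c j.+1) < e &
    edist (p%:R^-1 *: k) v < e].
Proof.
move=> fF /rotation_setP Fv e0.
have [L LP] := chain_bounded f e0.
have [D D0 DP] := lift_bounded fF.1 (homeo_leb_equivariant fF).
(* Bounds the contribution to [k - p *: v] of the closing chain, which has at most [L.+1] jumps; [m]
   is then taken with [C <= m * (e / 2)]. *)
pose C := L.+1%:R * (D + e + enorm v).
have C0 : 0 <= C by rewrite mulr_ge0// addr_ge0 ?enorm_ge0// addr_ge0 ?ltW.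
have e20 : 0 < e / 2 by rewrite divr_gt0.
have [m [u [Mm m0 muv]]] := Fv (Num.truncn (C / (e / 2))).+1 (e / 2) e20.
have Cm : C <= m%:R * (e / 2).
  rewrite -ler_pdivrMr// ltW// (lt_le_trans (truncnS_gt _))//.
  by rewrite ler_nat.
have [n nL] := LP (torus_pi (iter m F u)) (torus_pi u).
move=> /(reach_lift fF)[c' [c'0 c'n c'P]].
pose c j := if (j <= m)%N then iter j F u else c' (j - m)%N.
exists (m + n.+1)%N, c, (c' n.+1 - u).
have c0 : c 0%N = u by [].
have cge j : (m <= j)%N -> c j = c' (j - m)%N.
  rewrite /c leq_eqVlt => /orP[/eqP <-|mj]; first by rewrite leqnn subnn.
  by rewrite leqNgt mj.
have cp : c (m + n.+1)%N = c' n.+1 by rewrite cge ?leq_addr// addKn.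
split => //.
- by rewrite addnS.
- exact/torus_piP.
- by rewrite c0 cp subrKC.
- move=> j jp; have [jm|mj] := ltnP j m.
    by rewrite /c jm ltnW// edistxx.
  by rewrite !cge ?(leqW mj)// subSn// c'P//; lia.
set p := (m + n.+1)%N; have p0 : 0 < p%:R :> R by rewrite ltr0n /p addnS.
have -> : edist (p%:R^-1 *: (c' n.+1 - u)) v =
    p%:R^-1 * enorm (c' n.+1 - u - p%:R *: v).
  rewrite edist_enorm -{2}(@ger0_norm _ p%:R^-1) ?invr_ge0 ?ltW// -enormZ.
  by rewrite [in RHS]scalerBr scalerA mulVf ?lt0r_neq0// scale1r.
rewrite mulrC ltr_pdivrMr//.
have -> : c' n.+1 - u - p%:R *: v = (iter m F u - u - m%:R *: v) +
    ((c' n.+1 - c' 0%N) - n.+1%:R *: v).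
  by rewrite c'0 /p natrD scalerDl; ring.
have m0' : 0 < m%:R :> R by rewrite ltr0n.
have h1 : enorm (iter m F u - u - m%:R *: v) < m%:R * (e / 2).
  have -> : iter m F u - u - m%:R *: v =
      m%:R *: (m%:R^-1 *: (iter m F u - u) - v).
    by rewrite scalerBr scalerA mulfV ?lt0r_neq0// scale1r.
  by rewrite enormZ (gtr0_norm m0') ltr_pM2l// -edist_enorm.
have h2 : enorm (c' n.+1 - c' 0%N) <= n.+1%:R * (D + e).
  rewrite -edist_enorm; apply: (chain_displacement DP) => j jn.
  exact: c'P.
have h3 : enorm (n.+1%:R *: v) = n.+1%:R * enorm v.
  by rewrite enormZ ger0_norm.
have nC : n.+1%:R * (D + e) + n.+1%:R * enorm v <= C.
  rewrite -mulrDr ler_wpM2r// ?ler_nat//.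
  by rewrite addr_ge0 ?enorm_ge0// addr_ge0 ?ltW.
have := enormD (iter m F u - u - m%:R *: v) (c' n.+1 - c' 0%N - n.+1%:R *: v).
have := enormD (c' n.+1 - c' 0%N) (- (n.+1%:R *: v)); rewrite enormN h3.
have : e * p%:R = m%:R * (e / 2) + m%:R * (e / 2) + n.+1%:R * e.
  by rewrite /p natrD; field.
have : 0 <= n.+1%:R * e by rewrite mulr_ge0 ?ltW.
lra.
Qed.

End closed_chains.

(** * Grids and lattices *)

Section grids.
Context {R : realType}.
Implicit Types (u v w k : plane R) (x y z : torus R) (N : nat).

Lemma pow2_gt0 N : 0 < 2 ^+ N :> R. Proof. by rewrite exprn_gt0. Qed.

Lemma mesh_gt0 N : 0 < (2 ^+ N)^-1 :> R.
Proof. by rewrite invr_gt0 pow2_gt0. Qed.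

Lemma mesh_small (e : R) : 0 < e ->
  exists N0, forall N, (N0 <= N)%N -> (2 ^+ N)^-1 < e.
Proof.
move=> e0; exists (Num.truncn e^-1).+1 => N hN.
rewrite invf_plt ?posrE ?pow2_gt0// (lt_le_trans (truncnS_gt _))//.
rewrite -natrX ler_nat (leq_trans hN)//; exact/ltnW/ltn_expl.
Qed.

Lemma latticeP N u : lattice N u <->
  (u.1 * 2 ^+ N \is a Num.int) && (u.2 * 2 ^+ N \is a Num.int).
Proof.
have n0 : 2 ^+ N != 0 :> R by rewrite gt_eqF ?pow2_gt0.
split=> [[i _ [j _ <-]] /=|/andP[/intrP[i ui] /intrP[j uj]]].
  by rewrite !divfK// !intr_int.
by exists i => //; exists j => //; apply: plane_eq => /=; rewrite -?ui -?uj mulfK.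
Qed.

Lemma latticeD N u v : lattice N u -> lattice N v -> lattice N (u + v).
Proof.
move=> /latticeP/andP[u1 u2] /latticeP/andP[v1 v2]; apply/latticeP/andP.
by rewrite /= !mulrDl !rpredD.
Qed.

Lemma latticeN N u : lattice N u -> lattice N (- u).
Proof.
move=> /latticeP/andP[u1 u2]; apply/latticeP/andP.
by rewrite /= !mulNr !rpredN.
Qed.

Lemma integral_lattice N k : integral_vec k -> lattice N k.
Proof.
move=> /andP[k1 k2]; apply/latticeP/andP.
by split; rewrite rpredM// -natrX natr_int.
Qed.

Lemma lattice_le M N u : (M <= N)%N -> lattice M u -> lattice N u.
Proof.
move=> MN /latticeP/andP[u1 u2]; apply/latticeP/andP.
by rewrite -(subnKC MN) exprD !mulrA; split; rewrite rpredM// -natrX natr_int.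
Qed.

Lemma lattice_pi N u v : torus_pi u = torus_pi v -> lattice N u -> lattice N v.
Proof.
move=> /esym/torus_piP/(@integral_lattice N) uv Nu.
by rewrite -(subrK u v); exact: latticeD.
Qed.

Lemma lattice_eq0 N u : lattice N u -> enorm u < (2 ^+ N)^-1 -> u = 0.
Proof.
move=> /latticeP/andP[u1 u2] un.
have n0 := pow2_gt0 N.
have small (r : R) : r * 2 ^+ N \is a Num.int -> `|r| < (2 ^+ N)^-1 -> r = 0.
  move=> ir rn; apply/eqP; rewrite -(mulIr_eq0 _ (mulIf (lt0r_neq0 n0))).
  apply: contraLR rn => r0; rewrite -leNgt.
  have := norm_intr_ge1 ir r0.
  by rewrite normrM (gtr0_norm n0) -ler_pdivrMr// mul1r.
apply: plane_eq; apply: small => //; apply: le_lt_trans un.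
  by rewrite -[u.1]subr0; exact: (edist_fst u 0).
by rewrite -[u.2]subr0; exact: (edist_snd u 0).
Qed.

Lemma lattice_sep N u v : lattice N u -> lattice N v ->
  edist u v < (2 ^+ N)^-1 -> u = v.
Proof.
rewrite edist_enorm => Nu Nv uv; apply/eqP; rewrite -subr_eq0; apply/eqP.
by apply: lattice_eq0 uv; apply: latticeD => //; exact: latticeN.
Qed.

Lemma lattice_near N u : exists2 v, lattice N v & edist u v < 2 * (2 ^+ N)^-1.
Proof.
have n0 := pow2_gt0 N.
pose r (t : R) : R := (Num.floor (t * 2 ^+ N))%:~R / 2 ^+ N.
have rt t : `|t - r t| < (2 ^+ N)^-1.
  have /andP[f0 f1] := frac_itv (t * 2 ^+ N).
  have -> : t - r t = frac (t * 2 ^+ N) / 2 ^+ N.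
    by rewrite /r /frac mulrBl mulfK// lt0r_neq0.
  by rewrite normrM ger0_norm// ger0_norm ?invr_ge0 ?ltW// gtr_pMl// mesh_gt0.
exists (r u.1, r u.2).
  by exists (Num.floor (u.1 * 2 ^+ N)) => //; exists (Num.floor (u.2 * 2 ^+ N)).
by rewrite (le_lt_trans (edist_le _ _))// mulr_natl mulr2n ltrD/=.
Qed.

Definition grid_index N : finType := ('I_(2 ^ N) * 'I_(2 ^ N))%type.

Definition grid_point N (i : grid_index N) : plane R :=
  (i.1%:R / 2 ^+ N, i.2%:R / 2 ^+ N).

Lemma grid_point_lattice N (i : grid_index N) : lattice N (grid_point i).
Proof. by exists (i.1 : nat)%:Z => //; exists (i.2 : nat)%:Z. Qed.

Lemma gridP N x : grid N x <-> exists i : grid_index N, torus_pi (grid_point i) = x.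
Proof.
have lt_pow n : (n <= 2 ^ N - 1)%N = (n < 2 ^ N)%N.
  by rewrite -[in RHS](subnK (expn_gt0 2 N)) addn1 ltnS.
split=> [[i /= + [j /= + <-]]|[[i j] <-]].
  by rewrite !lt_pow => hi hj; exists (Ordinal hi, Ordinal hj).
by exists i => /=; [rewrite lt_pow|exists j => //=; rewrite lt_pow].
Qed.

Lemma grid_point_inj N (i j : grid_index N) :
  torus_pi (grid_point i) = torus_pi (grid_point j) -> i = j.
Proof.
have n0 := pow2_gt0 N.
have coord (a b : 'I_(2 ^ N)) :
    a%:R / 2 ^+ N - b%:R / 2 ^+ N \is a @Num.int R -> a = b.
  move=> ab; have lt1 (c : 'I_(2 ^ N)) : 0 <= (c%:R / 2 ^+ N : R) < 1.
    by rewrite divr_ge0 ?(ltW n0)//= ltr_pdivrMr// mul1r -natrX ltr_nat.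
  have : a%:R / 2 ^+ N - b%:R / 2 ^+ N = 0 :> R.
    apply/eqP; apply: contraT => /(norm_intr_ge1 ab).
    have /andP[? ?] := lt1 a; have /andP[? ?] := lt1 b.
    by rewrite leNgt ltr_norml; move=> /negP; case; apply/andP; split; lra.
  move=> /eqP; rewrite -mulrBl mulf_eq0 invr_eq0 (gt_eqF n0) orbF subr_eq0.
  by rewrite eqr_nat => /eqP/val_inj.
case: i j => [i1 i2] [j1 j2] /torus_piP /andP[/coord /= -> /coord /= ->].
by [].
Qed.

Lemma lattice_grid N u : lattice N u <-> grid N (torus_pi u).
Proof.
split=> [Nu|/gridP[i iu]]; last first.
  by apply: lattice_pi iu _; exact: grid_point_lattice.
have n0 := pow2_gt0 N.
have coord (r : R) : 0 <= r < 1 -> r * 2 ^+ N \is a Num.int ->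
    exists i : 'I_(2 ^ N), r = i%:R / 2 ^+ N.
  move=> /andP[r0 r1] /intrP[i ri].
  have i0 : 0 <= i by rewrite -(@ler0z R) -ri mulr_ge0// ltW.
  have iN : (`|i| < 2 ^ N)%N.
    rewrite -(@ltr_nat R) natr_absz ger0_norm// -ri natrX.
    by rewrite gtr_pMl.
  exists (Ordinal iN); apply: (mulIf (lt0r_neq0 n0)).
  by rewrite /= divfK ?lt0r_neq0// natr_absz ger0_norm.
have /latticeP/andP[v1 v2] : lattice N (frac_vec u).
  by apply: lattice_pi Nu; rewrite frac_vec_pi.
have [i iE] := coord _ (frac_itv u.1) v1.
have [j jE] := coord _ (frac_itv u.2) v2.
apply/gridP; exists (i, j); rewrite -(frac_vec_pi u); congr torus_pi.
by apply: plane_eq.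
Qed.

Lemma grid_sep N x y : grid N x -> grid N y -> tdist x y < (2 ^+ N)^-1 -> x = y.
Proof.
have [u <-] := torus_pi_surj x => /lattice_grid Nu Ny /tdist_ltP[v vy].
move: Ny; rewrite -vy => /lattice_grid Nv.
by move=> /(lattice_sep Nu Nv) ->.
Qed.

Lemma grid_near N x : exists2 y, grid N y & tdist x y < 2 * (2 ^+ N)^-1.
Proof.
have [u <-] := torus_pi_surj x; have [v Nv uv] := lattice_near N u.
exists (torus_pi v); first exact/lattice_grid.
exact: le_lt_trans (tdist_le u v) uv.
Qed.

(** Within half a mesh of [y] no choice is left to [P]: the grid points [P x] and [y] are less than
    a mesh apart. *)
Lemma grid_projection_eq N P x y : grid_projection N P -> grid N y ->
  tdist x y < (2 ^+ N)^-1 / 2 -> P x = y.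
Proof.
move=> hP Ny xy; have [NP /(_ y Ny) Pxy] := hP x.
apply: (grid_sep NP Ny); have := tdist_trans x (P x) y.
rewrite (tdist_sym (P x) x); move: Pxy; rewrite torus_mdistE torus_mdistE; lra.
Qed.

Section lifted_discretization.
Variables (N : nat) (P : torus R -> torus R) (Q : plane R -> plane R).
Hypothesis hQ : lattice_projection N P Q.

Lemma lattice_projection_lattice u : lattice N (Q u).
Proof. by case: hQ => /(_ u)[]. Qed.

Lemma lattice_projection_near u : edist u (Q u) < 2 * (2 ^+ N)^-1.
Proof.
have [v Nv uv] := lattice_near N u; case: hQ => /(_ u)[_ /(_ v Nv) Quv] _ _.
exact: le_lt_trans uv.
Qed.

Lemma lattice_projection_equivariant F : equivariant F -> equivariant (Q \o F).
Proof. by case: hQ => _ _ eQ eF u k ik /=; rewrite eF// eQ. Qed.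

Lemma lattice_projection_iter (f : torus R -> torus R) F n u : is_lift f F ->
  torus_pi (iter n (Q \o F) u) = iter n (P \o f) (torus_pi u).
Proof.
move=> fF; elim: n => [//|n IH]; rewrite !iterS -IH /=.
by case: hQ => _ -> _; rewrite (is_liftE _ fF).
Qed.

End lifted_discretization.

End grids.

(** * Rotation vectors of periodic orbits *)

Section iterates.
Context {R : realType}.
Implicit Types (u k : plane R) (S : plane R -> plane R).

Lemma iter_equivariant S n : equivariant S -> equivariant (iter n S).
Proof.
by move=> eS; elim: n => [//|n IH] u k ik; rewrite !iterS IH// eS.
Qed.

Lemma iter_period S p m u k : equivariant S -> integral_vec k ->
  iter p S u = u + k -> iter (m * p) S u = u + m%:R *: k.
Proof.
move=> eS ik Su; elim: m => [|m IH]; first by rewrite mul0n scale0r addr0.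
rewrite mulSn addnC iterD Su iter_equivariant// IH.
by rewrite -addn1 natrD scalerDl scale1r addrA.
Qed.

(** Compares both displacements over [p * q] iterates, where they become [q *: k] and [p *: l]. The
    rotation vector thus does not depend on the period used. *)
Lemma period_rotation S p q u k l : equivariant S ->
  (0 < p)%N -> (0 < q)%N -> integral_vec k -> integral_vec l ->
  iter p S u = u + k -> iter q S u = u + l -> p%:R^-1 *: k = q%:R^-1 *: l.
Proof.
move=> eS p0 q0 ik il Sp Sq.
have := iter_period q eS ik Sp; rewrite mulnC (iter_period p eS il Sq).
move=> /addrI pq; apply: (@scalerI _ _ (p%:R * q%:R)).
  by rewrite mulf_neq0// pnatr_eq0 -lt0n.
rewrite !scalerA mulrAC mulfV ?pnatr_eq0 -?lt0n// mul1r -pq.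
by rewrite mulfK// pnatr_eq0 -lt0n.
Qed.

End iterates.

(** * Grid maps with prescribed periodic orbits *)

Section attracting_map.
Context {R : realType}.
Implicit Types (u v w k : plane R) (x y z : torus R).

(* Follow a prescribed invariant set [O] and elsewhere go to the next point of
   a shortest chain to [O]; the length of that chain strictly decreases, so all
   periodic points lie in [O]. *)
Lemma attracting_map (f next : torus R -> torus R) (V O : set (torus R))
    (e : R) :
  O `<=` V -> (forall x, O x -> O (next x)) ->
  (forall x, O x -> tdist (f x) (next x) < e) ->
  (forall x, V x -> exists n y, O y /\ reach f V e n x y) ->
  exists s, [/\ forall x, V x -> V (s x) /\ tdist (f x) (s x) < e,
    forall x, O x -> s x = next x &
    forall x p, V x -> (0 < p)%N -> iter p s x = x -> O x].
Proof.
move=> OV Onext fnext VO.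
pose K x n := exists y, O y /\ reach f V e n x y.
have /choice[r rP] x : exists r, V x -> K x r /\ forall n, K x n -> (r <= n)%N.
  have [Vx|nVx] := pselect (V x); last by exists 0%N.
  have [n xn] := VO x Vx; have ex : exists n, `[< K x n >].
    by exists n; apply/asboolP.
  exists (ex_minn ex) => _; case: ex_minnP => m /asboolP Km mK; split => // l Kl.
  by apply: mK; apply/asboolP.
have /choice[s sP] x : exists y, V x -> [/\ V y, tdist (f x) y < e,
    O x -> y = next x & ~ O x -> O y \/ (r y < r x)%N].
  have [Vx|nVx] := pselect (V x); last by exists x.
  have [Ox|nOx] := pselect (O x).
    by exists (next x) => _; split => //; [exact/OV/Onext|exact: fnext].
  have [[y [Oy xy]] rmin] := rP x Vx.
  case E : (r x) xy => [|n] /= => [xy|[z [Vz xz zy]]].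
    by exists y => _; split => //; [exact: OV|move=> _; left].
  exists z => _; split => // _; right; rewrite ltnS.
  by apply: (rP z Vz).2; exists y.
exists s; split.
- by move=> x /sP[].
- by move=> x Ox; case: (sP x (OV _ Ox)) => _ _ /(_ Ox).
have Viter x n : V x -> V (iter n s x).
  by move=> Vx; elim: n => [//|n /sP[]]; rewrite iterS.
(* Either the orbit has entered [O], where it remains, or the rank has dropped at least once per
   step; a return to [x] is incompatible with the latter. *)
have dec x n : V x -> O (iter n s x) \/ (r (iter n s x) + n <= r x)%N.
  move=> Vx; elim: n => [|n IH]; first by right; rewrite addn0.
  rewrite iterS; set y := iter n s x in IH *.
  have [_ _ Oy nOy] := sP y (Viter x n Vx).
  have [Hy|Hy] := pselect (O y); first by left; rewrite (Oy Hy); exact: Onext.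
  case: IH => // IH; case: (nOy Hy) => [|lt]; [by left|right].
  by rewrite addnS (leq_trans _ IH)// -addSn leq_add2r.
move=> x p Vx p0 px.
have iterp m : iter (m * p) s x = x.
  by elim: m => [//|m IH]; rewrite mulSn iterD IH.
case: (dec x ((r x).+1 * p)%N Vx); rewrite iterp//.
by rewrite -[leqRHS]addn0 leq_add2l leqn0 muln_eq0/= => /eqP p00; rewrite p00 in p0.
Qed.

(* Rounding to a coarse lattice and then shifting the [t]-th point by [t] steps
   of the fine lattice makes all the points of the cycles distinct. *)
Lemma disjoint_lattice_cycles (F : plane R -> plane R) (e : R) (m : nat)
    (p : nat -> nat) (c : nat -> nat -> plane R) (k : nat -> plane R) :
  continuous F -> equivariant F -> 0 < e ->
  (forall i, (i < m)%N -> [/\ (0 < p i)%N, integral_vec (k i),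
    c i (p i) = c i 0%N + k i &
    forall j, (j < p i)%N -> edist (F (c i j)) (c i j.+1) < e]) ->
  exists N0, forall N, (N0 <= N)%N -> exists w : nat -> nat -> plane R,
    [/\ forall i j, (i < m)%N -> lattice N (w i j),
      forall i, (i < m)%N -> w i (p i) = w i 0%N + k i,
      forall i j, (i < m)%N -> (j < p i)%N ->
        edist (F (w i j)) (w i j.+1) < 3 * e &
      forall i j i' j', (i < m)%N -> (i' < m)%N -> (j < p i)%N -> (j' < p i')%N ->
        torus_pi (w i j) = torus_pi (w i' j') -> i = i' /\ j = j'].
Proof.
move=> cF eF e0 cP.
have [d0 d00 Fd0] := lift_ucont cF eF e0.
pose d := Num.min d0 e.
have dd : 0 < d by rewrite lt_min d00.
have Fd u v : edist u v < d -> edist (F u) (F v) < e.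
  by rewrite lt_min => /andP[/Fd0].
have de : d <= e by rewrite ge_min lexx orbT.
have d30 : 0 < d / 3 by rewrite divr_gt0.
have [M /(_ M (leqnn M)) Md] := mesh_small d30.
have /choice[rnd rndP] (u : plane R) :
    exists v, lattice M v /\ edist u v < 2 * (2 ^+ M)^-1.
  by have [v Mv uv] := lattice_near M u; exists v.
pose B := \max_(i < m) p i.
have pB i : (i < m)%N -> (p i <= B)%N.
  by move=> im; rewrite (@leq_bigmax _ (fun i : 'I_m => p i) (Ordinal im)).
(* Makes [m * B] fine steps at most one coarse mesh; [B] bounds all periods, so [i * B + j] is a
   distinct index below [m * B] for each pair. *)
exists (M + m * B)%N => N hN.
pose q : R := (2 ^+ N)^-1.
pose sh i j : plane R := ((i * B + j)%:R * q, 0).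
have sh_index i j : (i < m)%N -> (j < p i)%N -> (i * B + j < m * B)%N.
  move=> im jp; have jB := leq_trans jp (pB i im).
  by rewrite (leq_trans (_ : _ < i.+1 * B)%N) ?leq_mul2r ?im ?orbT// mulSn addnC ltn_add2r.
have q0 : 0 < q by exact: mesh_gt0.
have qM : (m * B)%:R * q <= (2 ^+ M)^-1.
  rewrite /q -(subnKC (leq_trans (leq_addr _ _) hN)) exprD invfM mulrCA ger_pMr ?mesh_gt0//.
  rewrite ler_pdivrMr ?pow2_gt0// mul1r -natrX ler_nat.
  by rewrite (leq_trans (ltnW (ltn_expl _ (ltnSn 1))))// leq_exp2l// leq_subRL ?(leq_trans (leq_addr _ _) hN).
have shM i j : (i < m)%N -> (j < p i)%N -> enorm (sh i j) < (2 ^+ M)^-1.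
  move=> im jp; rewrite /enorm /edist/= !subr0 expr0n addr0 sqrtr_sqr.
  rewrite ger0_norm ?mulr_ge0 ?(ltW q0)// (lt_le_trans _ qM)//.
  by rewrite ltr_pM2r// ltr_nat sh_index.
have shN i j : lattice N (sh i j).
  exists (i * B + j)%N%:Z => //; exists 0 => //.
  by apply: plane_eq => //=; rewrite mul0r.
(* The last point is defined as the translate of the first one, so that the shifted cycle still
   closes exactly. *)
pose w i j := if (j < p i)%N then rnd (c i j) + sh i j
  else rnd (c i 0%N) + sh i 0%N + k i.
have wc i j : (i < m)%N -> (j <= p i)%N -> edist (c i j) (w i j) < d.
  move=> im jp; have [p0 ik cp cF'] := cP i im.
  have near l : (l < p i)%N -> edist (c i l) (rnd (c i l) + sh i l) < d.
    move=> lp; have [_ cl] := rndP (c i l).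
    have := edist_triangle (rnd (c i l)) (c i l) (rnd (c i l) + sh i l).
    have -> : edist (rnd (c i l)) (rnd (c i l) + sh i l) = enorm (sh i l).
      by rewrite edist_enorm opprD addNKr enormN.
    by have := shM i l im lp; lra.
  rewrite /w; case: ltnP => [/near//|pj].
  have -> : j = p i by apply/eqP; rewrite eqn_leq jp.
  by rewrite cp edistD2r near.
exists w; split.
- move=> i j im; have [p0 ik _ _] := cP i im.
  have MN : (M <= N)%N by exact: leq_trans (leq_addr _ _) hN.
  rewrite /w; case: ifP => _; repeat apply: latticeD => //.
  + by apply: (lattice_le MN); case: (rndP (c i j)).
  + by apply: (lattice_le MN); case: (rndP (c i 0%N)).
  + exact: integral_lattice.
- by move=> i im; have [p0 _ _ _] := cP i im; rewrite /w ltnn p0.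
- move=> i j im jp; have [p0 ik cp cF'] := cP i im.
  have := Fd _ _ (wc i j im (ltnW jp)); have := wc i j.+1 im jp.
  have := cF' j jp.
  have := edist_triangle (F (c i j)) (F (w i j)) (w i j.+1).
  have := edist_triangle (c i j.+1) (F (c i j)) (w i j.+1).
  by rewrite (edistC (F (w i j)) (F (c i j))); lra.
- move=> i j i' j' im im' jp jp'; rewrite /w jp jp' => /torus_piP ww.
  have [[rM _] [rM' _]] := (rndP (c i j), rndP (c i' j')).
  (* The rounded points lie in the coarse lattice, so coincidence mod 1 puts the difference of the
     shifts there too; being shorter than the coarse mesh, it vanishes. *)
  have dM : lattice M (sh i j - sh i' j').
    have -> : sh i j - sh i' j' = (rnd (c i j) + sh i j - (rnd (c i' j') + sh i' j'))
        + (rnd (c i' j') - rnd (c i j)) by ring.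
    apply: latticeD; first exact: integral_lattice.
    by apply: latticeD => //; exact: latticeN.
  have : sh i j - sh i' j' = 0.
    apply: (lattice_eq0 dM); rewrite /enorm /edist/= !subr0 expr0n addr0 sqrtr_sqr.
    have lt1 := sh_index i j im jp; have lt2 := sh_index i' j' im' jp'.
    rewrite -mulrBl normrM (gtr0_norm q0) (lt_le_trans _ qM)// ltr_pM2r//.
    move: lt1 lt2; rewrite -!(@ltr_nat R).
    have := ler0n R (i * B + j); have := ler0n R (i' * B + j').
    by rewrite ltr_norml => ? ? ? ?; apply/andP; split; lra.
  move=> /eqP; rewrite subr_eq0 => /eqP /(congr1 fst) /= /(mulIf (lt0r_neq0 q0)).
  move=> /eqP; rewrite eqr_nat => /eqP sheq.
  have jB := leq_trans jp (pB i im); have jB' := leq_trans jp' (pB i' im').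
  have /(congr1 (divn^~ B)) := sheq; have /(congr1 (modn^~ B)) := sheq.
  rewrite !modnMDl !modn_small// => ->.
  have B0 : (0 < B)%N by exact: leq_ltn_trans jB.
  by rewrite !divnMDl// !divn_small// !addn0 => ->.
Qed.

End attracting_map.

(** * Prescribing discretizations near a homeomorphism *)

Section prescribed_discretization.
Context {R : realType}.
Variables (P : nat -> torus R -> torus R) (Q : nat -> plane R -> plane R).
Hypothesis hP : forall N, (0 < N)%N -> grid_projection N (P N).
Hypothesis hQ : forall N, (0 < N)%N -> lattice_projection N (P N) (Q N).
Implicit Types (u v w k : plane R) (x y : torus R) (F G H : plane R -> plane R).

(* The prescribed images are shifted by distinct amounts smaller than the mesh:
   this makes them distinct, as [move_points] requires, and keeps them inside
   the cells of the points [s x]. *)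
Lemma realize_grid_map (f : homeo_leb R) F (s : torus R -> torus R) (N : nat)
    (e : R) :
  is_lift f F -> (0 < N)%N -> 0 < e ->
  (forall x, grid N x -> grid N (s x) /\ tdist (f x) (s x) < e) ->
  exists (g : homeo_leb R) G (d : R), [/\ is_lift g G,
    forall u, edist (G u) (F u) <= 6 * (e + (2 ^+ N)^-1), 0 < d &
    forall (h : homeo_leb R) H, is_lift h H ->
      (forall u, edist (G u) (H u) <= d) -> forall x, grid N x -> P N (h x) = s x].
Proof.
move=> fF N0 e0 sP; pose q : R := (2 ^+ N)^-1; have q0 : 0 < q := mesh_gt0 N.
have gi (i : grid_index N) : grid N (torus_pi (grid_point i) : torus R).
  by apply/gridP; exists i.
have /choice[t tP] (i : grid_index N) : exists t,
    torus_pi t = s (torus_pi (grid_point i)) /\ edist (F (grid_point i)) t < e.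
  have [_] := sP _ (gi i).
  by rewrite -(is_liftE _ fF) => /tdist_ltP[t ts ti]; exists t.
pose I := grid_index N.
pose n := #|I|.
(* The rank of the index gives pairwise distinct shifts, all shorter than an eighth of the mesh. *)
pose sh (i : I) : plane R := ((enum_rank i)%:R / n%:R * (q / 8), 0).
have n0 : 0 < n%:R :> R.
  by rewrite ltr0n /n card_prod card_ord muln_gt0 expn_gt0.
have r01 (i : I) : 0 <= ((enum_rank i)%:R / n%:R : R) < 1.
  rewrite divr_ge0//= ?(ltW n0)// ltr_pdivrMr// mul1r ltr_nat.
  exact: ltn_ord.
have sh8 i : enorm (sh i) < q / 8.
  rewrite /enorm /edist/= !subr0 expr0n addr0 sqrtr_sqr.
  have /andP[r0 r1] := r01 i.
  by rewrite ger0_norm ?mulr_ge0 ?divr_ge0 ?(ltW q0)// gtr_pMl// divr_gt0.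
have tlat i : lattice N (t i).
  by apply/lattice_grid; rewrite (tP i).1; case: (sP _ (gi i)).
have winj i j : torus_pi (t i + sh i) = torus_pi (t j + sh j) -> i = j.
  move=> /torus_piP /(@integral_lattice _ N) tij.
  have : sh i - sh j = 0.
    apply: (@lattice_eq0 _ N).
      rewrite (_ : sh i - sh j = (t j - t i) + (t i + sh i - (t j + sh j))); last by ring.
      apply: latticeD => //; apply: latticeD => //; exact: latticeN.
    have := enormD (sh i) (- sh j); rewrite enormN.
    by have := sh8 i; have := sh8 j; rewrite -/q; lra.
  move=> /eqP; rewrite subr_eq0 => /eqP /(congr1 fst) /= /(mulIf _) rij.
  apply: enum_rank_inj; apply/val_inj/eqP; rewrite -(@eqr_nat R).
  apply/eqP/(mulIf (lt0r_neq0 (_ : 0 < n%:R^-1))); first by rewrite invr_gt0.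
  by apply: rij; rewrite lt0r_neq0// divr_gt0.
have uinj i j : torus_pi (F (@grid_point R N i)) = torus_pi (F (grid_point j)) -> i = j.
  by rewrite !(is_liftE _ fF) => /homeo_leb_inj/grid_point_inj.
have eq0 : 0 < e + q by rewrite addr_gt0.
have [i|g' [G' [gG' G'near G'E]]] := move_points eq0 _ uinj winj.
  have := edist_triangle (t i) (F (grid_point i)) (t i + sh i).
  have -> : edist (t i) (t i + sh i) = enorm (sh i).
    by rewrite edist_enorm opprD addNKr enormN.
  by have := sh8 i; have := (tP i).2; lra.
have [g gE] := homeo_leb_comp g' f.
(* The shift and the passage from [G] to [H] cost at most [q / 8] each, which stays below the half
   mesh allowed by [grid_projection_eq]. *)
exists g, (G' \o F), (q / 8); split.
- by rewrite gE; exact: is_lift_comp.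
- by move=> u; exact: G'near.
- by rewrite divr_gt0.
move=> h H hH GH x /gridP[i <-].
apply: (grid_projection_eq (hP N0)); first by case: (sP _ (gi i)).
rewrite -(tP i).1 -(is_liftE _ hH) (le_lt_trans (tdist_le _ _))//.
have := GH (grid_point i); rewrite /= G'E edistC.
have := edist_triangle (t i + sh i) (H (grid_point i)) (t i).
have -> : edist (t i + sh i) (t i) = enorm (sh i).
  by rewrite edist_enorm addrAC subrr add0r.
by have := sh8 i; rewrite -/q; lra.
Qed.

(** Hausdorff closeness to a finite set, given as a list so that rational instances can be
    enumerated. *)
Definition rotation_near (f : torus R -> torus R) F N (A : seq (plane R))
    (e : R) :=
  (forall v, discrete_rotation_set P Q f F N v ->
    exists2 a, a \in A & edist v a < e) /\
  (forall a, a \in A ->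
    exists2 v, discrete_rotation_set P Q f F N v & edist v a < e).

(** The density half of the genericity argument: near [f] there is a whole ball of maps whose
    discretization at one fine level has rotation set close to [A]. *)
Lemma perturb_rotation_set (f : homeo_leb R) F (A : seq (plane R)) (e : R)
    (n : nat) :
  is_lift f F -> A != [::] -> (forall a, a \in A -> rotation_set F a) -> 0 < e ->
  exists (N : nat) (g : homeo_leb R) G (d : R),
    [/\ (n <= N)%N /\ (0 < N)%N, is_lift g G,
    forall u, edist (G u) (F u) <= e, 0 < d &
    forall (h : homeo_leb R) H, is_lift h H ->
      (forall u, edist (G u) (H u) <= d) -> rotation_near h H N A e].
Proof.
move=> fF A0 AF e0.
have eF := homeo_leb_equivariant fF.
(* The perturbation costs [6 * (3 * b + mesh)], with the mesh below [b / 2], hence at most [21 * b];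
   the estimate identifying lifts below totals less than [26 * b], and must be under 1. *)
pose b := Num.min e 1 / 100.
have b0 : 0 < b by rewrite divr_gt0// lt_min e0 ltr01.
have [be b1] : b * 100 <= e /\ b * 100 <= 1.
  by rewrite /b divfK// !ge_min !lexx orbT.
pose m := size A.
have m0 : (0 < m)%N by rewrite lt0n size_eq0.
have /choice[p /choice[c /choice[k pckP]]] (i : nat) :
    exists p (c : nat -> plane R) k, (i < m)%N -> [/\ (0 < p)%N, integral_vec k,
    c p = c 0%N + k, forall j, (j < p)%N -> edist (F (c j)) (c j.+1) < b &
    edist (p%:R^-1 *: k) (nth 0 A i) < b].
  have [im|_] := ltnP i m; last by exists 0%N, (fun=> 0), 0.
  have [p [c [k pck]]] := closed_chain fF (AF _ (mem_nth 0 im)) b0.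
  by exists p, c, k.
have [|N0 N0P] := disjoint_lattice_cycles (m := m) (p := p) (c := c) (k := k) fF.1 eF b0.
  by move=> i /pckP[].
have [d0 d00 fd0] := torus_ucont (@homeo_leb_cont R f) b0.
pose d1 := Num.min d0 b.
have d10 : 0 < d1 by rewrite lt_min d00.
have d1b : d1 <= b by rewrite ge_min lexx orbT.
have d12 : 0 < d1 / 2 by rewrite divr_gt0.
have [N1 N1P] := mesh_small d12.
pose N := (maxn (maxn N0 N1) n).+1.
have N_gt0 : (0 < N)%N by [].
have [NN0 NN1 NNn] : [/\ N0 <= N, N1 <= N & n <= N]%N.
  by rewrite /N; split; rewrite leqW// !leq_max leqnn ?orbT.
have qd : (2 ^+ N)^-1 < d1 / 2 := N1P N NN1.
have [w [wN wp wF winj]] := N0P N NN0.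
pose O := [set x | exists i j, [/\ (i < m)%N, (j < p i)%N & x = torus_pi (w i j)]].
have /choice[next nextP] (x : torus R) : exists y, forall i j,
    (i < m)%N -> (j < p i)%N -> x = torus_pi (w i j) -> y = torus_pi (w i j.+1).
  have [[i [j [im jp xw]]]|nO] := pselect (O x); last first.
    by exists x => i j im jp xw; exfalso; apply: nO; exists i, j.
  exists (torus_pi (w i j.+1)) => i' j' im' jp'; rewrite xw.
  by move=> /(winj _ _ _ _ im im' jp jp')[-> ->].
have p_gt0 i : (i < m)%N -> (0 < p i)%N by move=> /pckP[].
have wlast i : (i < m)%N -> torus_pi (w i (p i)) = torus_pi (w i 0%N).
  by move=> im; rewrite wp// torus_piD//; case: (pckP i im).
have OV : O `<=` grid N.
  by move=> x [i [j [im jp ->]]]; apply/lattice_grid; exact: wN.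
have b30 : 0 < 3 * b by rewrite mulr_gt0.
have [s [sN sO sper]] : exists s : torus R -> torus R,
    [/\ forall x, grid N x -> grid N (s x) /\ tdist (f x) (s x) < 3 * b,
    forall x, O x -> s x = next x &
    forall x p, grid N x -> (0 < p)%N -> iter p s x = x -> O x].
  apply: attracting_map => //.
  - move=> x [i [j [im jp xw]]]; rewrite (nextP x i j im jp xw).
    have := jp; rewrite leq_eqVlt => /orP[/eqP jp1|jp1].
      by exists i, 0%N; rewrite jp1 wlast//; split => //; exact: p_gt0.
    by exists i, j.+1.
  - move=> x [i [j [im jp xw]]]; rewrite (nextP x i j im jp xw) xw.
    by rewrite -(is_liftE _ fF) (le_lt_trans (tdist_le _ _))// wF.
  - move=> x Nx; pose y := torus_pi (w 0%N 0%N).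
    have [l xy] := chain_transitive f x y b0; exists l, y; split.
      by exists 0%N, 0%N; split => //; exact: p_gt0.
    (* The chain given by transitivity is moved onto the grid, which is [d1]-dense since its mesh is
       below [d1 / 2]. *)
    apply: (@reach_le _ _ _ (2 * b + d1)); first by lra.
    apply: (reach_perturb d10 _ _ _ _ xy); rewrite ?tdistxx//.
      move=> z; have [z' Nz' zz'] := grid_near N z; exists z' => //.
      by rewrite (lt_le_trans zz')//; lra.
    move=> z z' zz'; apply: fd0; apply: lt_le_trans zz' _.
    by rewrite ge_min lexx.
have [g [G [d [gG GF d_gt0 dP]]]] := realize_grid_map fF N_gt0 b30 sN.
exists N, g, G, (Num.min d b); split => //.
- by move=> u; rewrite (le_trans (GF u))//; lra.
- by rewrite lt_min d_gt0.
move=> h H hH GH.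
have {}dP x : grid N x -> P N (h x) = s x.
  by apply: (dP h H hH) => u; rewrite (le_trans (GH u))// ge_min lexx.
have eH := homeo_leb_equivariant hH.
pose S := Q N \o H.
have eS : equivariant S := lattice_projection_equivariant (hQ N_gt0) eH.
have Sw i j : (i < m)%N -> (j < p i)%N -> S (w i j) = w i j.+1.
  (* Knowing the discretization on the torus determines [S (w i j)] up to an integral vector;
     closeness of [H] to [F] excludes a nonzero one. *)
  move=> im jp; apply: lift_unique.
    rewrite (lattice_projection_iter (hQ N_gt0) 1 (w i j) hH)/= dP.
      have Ow : O (torus_pi (w i j)) by exists i, j.
      by rewrite (sO _ Ow) (nextP _ i j).
    by apply/lattice_grid; exact: wN.
  have := lattice_projection_near (hQ N_gt0) (H (w i j)).
  have : edist (G (w i j)) (H (w i j)) <= b.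
    by rewrite (le_trans (GH _))// ge_min lexx orbT.
  have := GF (w i j); have := wF i j im jp.
  have := edist_triangle (H (w i j)) (S (w i j)) (w i j.+1).
  have := edist_triangle (G (w i j)) (H (w i j)) (w i j.+1).
  have := edist_triangle (F (w i j)) (G (w i j)) (w i j.+1).
  rewrite (edistC (H (w i j)) (G (w i j))) (edistC (S (w i j)) (H (w i j))) /S /=.
  by lra.
have Sw0 i j : (i < m)%N -> (j <= p i)%N -> iter j S (w i 0%N) = w i j.
  move=> im; elim: j => [//|j IH jp]; rewrite iterS IH ?Sw//; exact: ltnW.
have Swp i j : (i < m)%N -> (j < p i)%N -> iter (p i) S (w i j) = w i j + k i.
  move=> im jp; rewrite -(Sw0 i j im (ltnW jp)) -iterD addnC iterD Sw0// wp//.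
  by rewrite iter_equivariant//; case: (pckP i im).
have SP r u : torus_pi (iter r S u) = iter r (P N \o h) (torus_pi u).
  exact: (lattice_projection_iter (hQ N_gt0) r u hH).
split=> [v [x [r [u [Nx r0 xr ux ->]]]]|a aA].
- have [|i [j [im jp xw]]] := sper x r Nx r0.
    have sx l : iter l s x = iter l (P N \o h) x /\ grid N (iter l s x).
      elim: l => [//|l [IH1 IH2]]; rewrite !iterS -IH1 /= dP//; split => //.
      by case: (sN _ IH2).
    by rewrite (sx r).1.
  have [_ ik _ _ ka] := pckP i im.
  exists (nth 0 A i); first exact: mem_nth.
  suff -> : r%:R^-1 *: (iter r S u - u) = (p i)%:R^-1 *: k i.
    by rewrite (lt_le_trans ka)//; lra.
  have il : integral_vec (iter r S u - u).
    by apply/torus_piP; rewrite SP ux.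
  apply: (period_rotation (u := u) eS r0 (p_gt0 i im) il ik).
    by rewrite subrKC.
  have /torus_piP iu : torus_pi u = torus_pi (w i j) by rewrite ux.
  have -> : u = w i j + (u - w i j) by rewrite subrKC.
  by rewrite iter_equivariant// Swp// addrAC.
- have [i im ia] : exists2 i, (i < m)%N & nth 0 A i = a by apply/(nthP 0).
  have [pi0 ik _ _ ka] := pckP i im; have Sp := Swp i 0%N im pi0.
  exists ((p i)%:R^-1 *: k i); last by rewrite -ia (lt_le_trans ka)//; lra.
  exists (torus_pi (w i 0%N)), (p i), (w i 0%N); split => //.
  + by apply/lattice_grid; exact: wN.
  + by rewrite -SP Sp torus_piD.
  + by rewrite -[lift_discretization _ _ _]/S Sp addrAC subrr add0r.
Qed.

End prescribed_discretization.

(** * Shadowing periodic orbits of discretizations *)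

Section shadowing.
Context {R : realType}.
Implicit Types (u v w k : plane R) (x y : torus R) (F G H : plane R -> plane R).

Lemma iter_close G (m : nat) (e : R) : continuous G -> equivariant G -> 0 < e ->
  exists2 d, 0 < d & forall H, (forall u, edist (G u) (H u) <= d) ->
    forall u, edist (iter m G u) (iter m H u) < e.
Proof.
move=> cG eG; elim: m e => [|m IH] e e0.
  by exists 1 => // H _ u; rewrite edistxx.
have e20 : 0 < e / 2 by rewrite divr_gt0.
have [d1 d10 Gd] := lift_ucont cG eG e20.
have [d2 d20 dP] := IH d1 d10.
exists (Num.min d2 (e / 2)); first by rewrite lt_min d20.
move=> H GH u; rewrite !iterS.
have := edist_triangle (G (iter m H u)) (G (iter m G u)) (H (iter m H u)).
have : edist (G (iter m H u)) (H (iter m H u)) <= e / 2.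
  by rewrite (le_trans (GH _))// ge_min lexx orbT.
have : edist (G (iter m G u)) (G (iter m H u)) < e / 2.
  apply/Gd/dP => z; rewrite (le_trans (GH z))// ge_min lexx //.
lra.
Qed.

(* A periodic orbit of the discretization, followed for a long time, is turned
   into an orbit of distinct points by shifting its [j]-th point by [j * d]. *)
Lemma perturb_orbit (P : nat -> torus R -> torus R) (Q : nat -> plane R -> plane R)
    (f : homeo_leb R) F (e : R) :
  (forall N, (0 < N)%N -> lattice_projection N (P N) (Q N)) ->
  is_lift f F -> 0 < e ->
  exists N0, forall N n v, (N0 <= N)%N -> discrete_rotation_set P Q f F N v ->
  exists (g : homeo_leb R) G (d : R), [/\ is_lift g G,
    forall u, edist (G u) (F u) <= e, 0 < d &
    forall H, (forall u, edist (G u) (H u) <= d) ->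
      exists m u, [/\ (n <= m)%N, (0 < m)%N &
        edist (m%:R^-1 *: (iter m H u - u)) v < e]].
Proof.
move=> hQ fF e0; have eF := homeo_leb_equivariant fF.
(* The points are moved by at most [4 * b], and [move_points] multiplies this by 6. *)
pose b := e / 24; have b0 : 0 < b by rewrite divr_gt0.
have [N1 N1P] := mesh_small b0.
exists N1.+1 => N n v NN [x [p [u [Nx p0 px ux ->]]]].
have N0 : (0 < N)%N by exact: leq_ltn_trans NN.
have qb : (2 ^+ N)^-1 < b := N1P N (ltnW NN).
have q0 := mesh_gt0 N.
pose S := Q N \o F.
have eS : equivariant S := lattice_projection_equivariant (hQ N N0) eF.
have ik : integral_vec (iter p S u - u).
  apply/torus_piP; rewrite (lattice_projection_iter (hQ N N0) p u fF) ux.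
  exact: px.
set k := iter p S u - u in ik.
pose m := (n.+1 * p)%N.
have m0 : (0 < m)%N by rewrite muln_gt0.
have mR : 0 < m%:R :> R by rewrite ltr0n.
have Sm : iter m S u = u + n.+1%:R *: k.
  by apply: iter_period => //; rewrite subrKC.
have [d1 d10 Fd] := lift_ucont fF.1 eF b0.
(* All shifts [j * d] with [j <= m] stay within half of each of the three bounds; being below the
   mesh, they separate the successive passages through one lattice point. *)
pose d := Num.min (Num.min d1 b) (2 ^+ N)^-1 / (m%:R * 2).
have d0 : 0 < d by rewrite divr_gt0 ?mulr_gt0// !lt_min d10 b0 mesh_gt0.
have md (i : nat) : (i <= m)%N -> [/\ i%:R * d < d1, i%:R * d < b & i%:R * d < (2 ^+ N)^-1].
  move=> im; have : i%:R * d <= m%:R * d by rewrite ler_pM2r// ler_nat.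
  have -> : m%:R * d = Num.min (Num.min d1 b) (2 ^+ N)^-1 / 2.
    by rewrite /d; field; rewrite lt0r_neq0.
  set c := Num.min _ _ => ic.
  have : [/\ c <= d1, c <= b & c <= (2 ^+ N)^-1] by rewrite /c !ge_min !lexx !orbT.
  have c0 : 0 < c by rewrite !lt_min d10 b0 mesh_gt0.
  by move=> [? ? ?]; split; lra.
pose sh (j : nat) : plane R := (j%:R * d, 0).
have shE j : enorm (sh j) = j%:R * d.
  by rewrite /enorm /edist/= !subr0 expr0n addr0 sqrtr_sqr ger0_norm// mulr_ge0// ltW.
pose w j := iter j S u + sh j.
have Su j : lattice N (iter j S u).
  case: j => [|j]; first by apply/lattice_grid; rewrite ux.
  exact: (lattice_projection_lattice (hQ N N0)).
have winj i j : (i <= m)%N -> (j <= m)%N -> torus_pi (w i) = torus_pi (w j) -> i = j.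
  move=> im jm /torus_piP /(@integral_lattice _ N) wij.
  have : sh i - sh j = 0.
    apply: (@lattice_eq0 _ N).
      rewrite (_ : sh i - sh j = (w i - w j) + (iter j S u - iter i S u)); last first.
        by rewrite /w; ring.
      by apply: latticeD => //; apply: latticeD => //; exact: latticeN.
    rewrite (_ : sh i - sh j = (i%:R * d - j%:R * d, 0)); last first.
      by apply: plane_eq => //=; rewrite subr0.
    rewrite /enorm /edist/= !subr0 expr0n addr0 sqrtr_sqr ltr_norml.
    have [_ _ ?] := md i im; have [_ _ ?] := md j jm.
    have : 0 <= i%:R * d by rewrite mulr_ge0// ltW.
    have : 0 <= j%:R * d by rewrite mulr_ge0// ltW.
    by move=> ? ?; apply/andP; split; lra.
  move=> /eqP; rewrite subr_eq0 => /eqP /(congr1 fst) /= /(mulIf (lt0r_neq0 d0)).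
  by move=> /eqP; rewrite eqr_nat => /eqP.
have wnear (i : 'I_m) : edist (F (w i)) (w i.+1) <= 4 * b.
  have im := ltn_ord i.
  have [id1 _ _] := md i (ltnW im); have [_ ib _] := md i.+1 im.
  have : edist (F (w i)) (F (iter i S u)) < b.
    apply: Fd; rewrite edist_enorm /w addrAC subrr add0r shE.
    exact: id1.
  have := lattice_projection_near (hQ N N0) (F (iter i S u)).
  rewrite (_ : Q N (F _) = iter i.+1 S u)//.
  have : edist (iter i.+1 S u) (w i.+1) < b.
    by rewrite edist_enorm /w opprD addNKr enormN shE.
  have := edist_triangle (F (iter i S u)) (F (w i)) (w i.+1).
  have := edist_triangle (iter i.+1 S u) (F (iter i S u)) (w i.+1).
  lra.
have b40 : 0 < 4 * b by rewrite mulr_gt0.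
have [||g' [G' [gG' G'near G'E]]] := @move_points R 'I_m
  (fun i => F (w i)) (fun i => w i.+1) _ b40 wnear.
- move=> i j; rewrite !(is_liftE _ fF) => /homeo_leb_inj/winj ij.
  by apply/val_inj/ij; exact: ltnW.
- move=> i j /winj ij; apply/val_inj/succn_inj/ij; exact: ltn_ord.
have [g gE] := homeo_leb_comp g' f.
have gG : is_lift g (G' \o F) by rewrite gE; exact: is_lift_comp.
have Gw j : (j <= m)%N -> iter j (G' \o F) (w 0%N) = w j.
  elim: j => [//|j IH jm]; rewrite iterS IH ?(ltnW jm)//=.
  exact: (G'E (Ordinal jm)).
(* The tolerance may be proportional to [m], since the displacement gets divided by [m]; the other
   half absorbs the final shift [m * d]. *)
have [|d' d'0 d'P] := @iter_close (G' \o F) m (m%:R * (e / 2)) gG.1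
  (homeo_leb_equivariant gG).
  by rewrite mulr_gt0// divr_gt0.
exists g, (G' \o F), d'; split => //.
  move=> z; rewrite (le_trans (G'near _))// /b; lra.
move=> H GH; exists m, (w 0%N); split => //.
  by rewrite (leq_trans (leqnSn n))// leq_pmulr.
rewrite (_ : p%:R^-1 *: (iter p (lift_discretization Q F N) u - u) =
    m%:R^-1 *: (n.+1%:R *: k)); last first.
  rewrite scalerA /m natrM; congr (_ *: _).
  by rewrite invfM mulrAC mulVf ?mul1r// pnatr_eq0.
rewrite edist_enorm -scalerBr enormZ gtr0_norm ?invr_gt0//.
rewrite mulrC ltr_pdivrMr//.
rewrite (_ : iter m H (w 0%N) - w 0%N - n.+1%:R *: k =
  (iter m H (w 0%N) - iter m (G' \o F) (w 0%N)) + sh m); last first.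
  rewrite Gw// /w Sm /= (_ : sh 0%N = 0); last by apply: plane_eq => //=; rewrite mul0r.
  by ring.
have := enormD (iter m H (w 0%N) - iter m (G' \o F) (w 0%N)) (sh m).
rewrite shE -edist_enorm edistC.
have := d'P H GH (w 0%N); have [_ mb _] := md m (leqnn m).
have : e <= m%:R * e by rewrite ler_peMl// ?(ltW e0)// ler1n.
by rewrite /b in mb *; lra.
Qed.

End shadowing.

(** * The Baire property *)

Section completeness.
Context {R : realType}.
Implicit Types (x y z : torus R).

(** [torus_leb] is a bare set function; this bundles it as a measure for continuity and uniqueness
    arguments. *)
Lemma torus_leb_measure : exists mu : {measure set (torus R) -> \bar R},
  forall A, mu A = torus_leb A.
Proof.
rewrite /torus_leb; set m := mrestr _ _.
by unshelve eexists (pushforward m torus_pi); first exact: torus_pi_measurable.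
Qed.

Lemma image_measure (f : torus R -> torus R) : continuous f ->
  exists mu : {measure set (torus R) -> \bar R},
  forall A, mu A = torus_leb (f @^-1` A).
Proof.
move=> cf; have [nu nuE] := torus_leb_measure.
unshelve eexists (pushforward nu f); last by move=> A; exact: nuE.
by move=> _ A mA; rewrite setTI; exact: continuous_preimage_measurable.
Qed.

Lemma torus_open_measurable (U : set (torus R)) : open U -> measurable U.
Proof. exact: sub_sigma_algebra. Qed.

Lemma preserves_leb_open_le (f : torus R -> torus R) (U : set (torus R)) :
  continuous f ->
  (forall e : R, 0 < e -> exists h, [/\ continuous h, preserves_leb h &
    forall x, tdist (h x) (f x) < e]) ->
  open U -> (torus_leb U <= torus_leb (f @^-1` U))%E.
Proof.
move=> cf hf oU; have [mu muE] := torus_leb_measure.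
pose W n := [set y | exists2 z, ~ U z & tdist y z < n.+1%:R^-1].
have oW n : open (W n).
  move=> y [z nUz yz]; apply/torus_nbhsP.
  exists (n.+1%:R^-1 - tdist y z); first by rewrite subr_gt0.
  move=> t yt; exists z => //; rewrite (le_lt_trans (tdist_trans y t z))//.
  by rewrite tdist_sym -ltrBrDr.
pose V n := ~` W n.
have mV n : measurable (V n).
  by apply: measurableC; exact: torus_open_measurable.
have VU : \bigcup_n V n = U.
  apply/seteqP; split=> [y [n _ nWy]|y Uy].
    apply: contrapT => nUy; apply: nWy; exists y => //.
    by rewrite tdistxx invr_gt0.
  have /torus_nbhsP[e e0 eU] : nbhs y U by exact: open_nbhs_nbhs.
  exists (Num.truncn e^-1) => // -[z nUz yz]; apply: nUz; apply: eU.
  rewrite (lt_le_trans yz)// invf_ple ?posrE// ltW// truncnS_gt//.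
have V_mono : nondecreasing_seq V.
  move=> n m nm; apply/subsetPset; apply: subsetC => y [z nUz yz]; exists z => //.
  by rewrite (lt_le_trans yz)// lef_pV2 ?posrE// ler_nat ltnS.
have Vlim : mu (V n) @[n --> \oo] --> mu U.
  rewrite -VU; apply: nondecreasing_cvg_mu => //.
  by rewrite VU; exact: torus_open_measurable.
have Vle n : (mu (V n) <= torus_leb (f @^-1` U))%E.
  have [|h [ch ph hfn]] := hf n.+1%:R^-1; first by rewrite invr_gt0.
  rewrite muE -ph// -!muE; apply: le_measure.
  - by rewrite inE; exact: continuous_preimage_measurable.
  - rewrite inE; apply: continuous_preimage_measurable => //.
    exact: torus_open_measurable.
  - by move=> x /= nWhx; apply: contrapT => nUfx; apply: nWhx; exists (f x).
rewrite -muE -(cvg_lim _ Vlim)//; apply: lime_le; first by apply: cvgP Vlim.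
by apply: nearW.
Qed.

(** The inequality on open sets, applied to [f] and to its inverse, gives equality there; open sets
    are stable under intersection and generate the Borel sets. *)
Lemma preserves_leb_limit (f g : torus R -> torus R) :
  continuous f -> continuous g -> cancel f g -> cancel g f ->
  (forall e : R, 0 < e -> exists h h', [/\ continuous h, continuous h',
    cancel h h', preserves_leb h &
    forall x, tdist (h x) (f x) < e /\ tdist (h' x) (g x) < e]) ->
  preserves_leb f.
Proof.
move=> cf cg fg gf hP A mA.
have [mu muE] := torus_leb_measure; have [nu nuE] := image_measure cf.
rewrite -nuE -muE; apply/esym.
apply: (measure_unique [set U : set (torus R) | open U] (fun=> setT)) => //.
- by move=> U V oU oV; exact: openI.
- by move=> _; exact: openT.
- by rewrite bigcup_const.
- move=> U oU; apply/eqP; rewrite eq_le muE nuE; apply/andP; split.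
    apply: preserves_leb_open_le => // e e0.
    by have [h [h' [ch ch' hh' ph hfP]]] := hP e e0; exists h; split => // x; case: (hfP x).
  have -> : torus_leb U = torus_leb (g @^-1` (f @^-1` U)).
    by congr torus_leb; apply/seteqP; split=> x; rewrite /preimage/= gf.
  apply: preserves_leb_open_le => // [e e0|]; last first.
    by apply: open_comp => // x _; exact: cf.
  have [h [h' [ch ch' hh' ph hfP]]] := hP e e0.
  exists h'; split; [exact: ch'| |by move=> x; case: (hfP x)].
  move=> B mB; rewrite -ph; last exact: continuous_preimage_measurable.
  by congr torus_leb; apply/seteqP; split=> x; rewrite /preimage/= hh'.
- by move=> _; rewrite muE torus_leb_setT ltry.
Qed.

(** Any cluster point works, since all terms from the [n]-th on lie within [r n] of [a n]. *)
Lemma torus_complete (a : nat -> torus R) (r : nat -> R) :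
  (forall n m, (n <= m)%N -> tdist (a n) (a m) <= r n) ->
  exists y, forall n, tdist (a n) y <= r n.
Proof.
move=> ar; have : (a @ \oo) setT by exact: filterT.
move=> /(@torus_compact R (a @ \oo) _)[y [_ cy]]; exists y => n.
apply/ler_addgt0Pl => e e0.
have [z [[m /= nm <-] /= zy]] : [set a m | m in [set m | (n <= m)%N]]
    `&` [set z | tdist z y < e] !=set0.
  apply: cy; first by exists n => // m /= nm; exists m.
  by apply/torus_nbhsP; exists e => // z; rewrite tdist_sym.
rewrite (le_trans (tdist_trans (a m) _ _))// addrC lerD ?ar//.
exact: ltW.
Qed.

Lemma homeo_leb_open_ball (U : set (homeo_leb R)) f : open U -> U f ->
  exists2 r, 0 < r & forall g, unif_dist f g < r -> U g.
Proof.
move=> oU Uf; have /metric_nbhsP[r r0 rP] : nbhs f U by exact: open_nbhs_nbhs.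
by exists r.
Qed.

Lemma homeo_leb_open (U : set (homeo_leb R)) :
  (forall f, U f -> exists2 r, 0 < r & forall g, unif_dist f g < r -> U g) ->
  open U.
Proof.
by move=> UP; rewrite openE => f /UP[r r0 rP]; apply/metric_nbhsP; exists r.
Qed.

(** Here [x] and [y] are the preimages of one point under [f] and [g], so this controls the distance
    between inverses; it comes from uniform continuity of the inverse of [f]. *)
Lemma inverse_close (f : homeo_leb R) (e : R) : 0 < e ->
  exists2 r, 0 < r & forall g x y, unif_dist f g < r -> f x = g y -> tdist x y < e.
Proof.
move=> e0; have [_ [g [cg fg _]] _ _] := homeo_lebE f.
have [r r0 rP] := torus_ucont cg e0; exists r => // h x y fh fxhy.
rewrite -(fg x) -(fg y); apply: rP; rewrite fxhy tdist_sym.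
exact: le_lt_trans (unif_dist_tdist f h y) fh.
Qed.

(* The metric of uniform convergence is not complete: the radii of the nested
   balls are chosen so as to make the inverses converge uniformly as well. *)
Lemma homeo_leb_Baire (U : nat -> set (homeo_leb R)) :
  (forall n, open (U n) /\ dense (U n)) -> dense (\bigcap_n U n).
Proof.
move=> oU O [f0 Of0] oO.
have udC (f g : homeo_leb R) : unif_dist f g = unif_dist g f.
  exact: (@metric_sym R (homeo_leb R)).
have udT (g f h : homeo_leb R) : unif_dist f h <= unif_dist f g + unif_dist g h.
  exact: (@metric_triangle R (homeo_leb R)).
have udxx (f : homeo_leb R) : unif_dist f f = 0.
  exact: (@mdistxx R (homeo_leb R)).
have [r0 r00 r0P] := homeo_leb_open_ball oO Of0.
pose good (n : nat) (f : homeo_leb R) (r : R) := [/\ 0 < r, r <= n.+1%:R^-1,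
  forall g, unif_dist f g <= r -> U n g &
  forall g x y, unif_dist f g <= r -> f x = g y -> tdist x y < n.+1%:R^-1].
have step n (p : homeo_leb R * R) : exists q : homeo_leb R * R, 0 < p.2 ->
    good n q.1 q.2 /\ unif_dist p.1 q.1 + q.2 < p.2.
  have [p0|p0] := ltP 0 p.2; last by exists p.
  have [oUn dUn] := oU n.
  have near_p (g : homeo_leb R) : unif_dist p.1 g < p.2 ->
      exists2 r, 0 < r & forall h, unif_dist g h < r -> unif_dist p.1 h < p.2.
    move=> pg; exists (p.2 - unif_dist p.1 g); first by rewrite subr_gt0.
    by move=> h gh; have := udT g p.1 h; lra.
  have [|g [pg Ug]] := dUn [set g | unif_dist p.1 g < p.2] _ (homeo_leb_open near_p).
    by exists p.1; rewrite /= udxx.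
  have [r1 r10 r1P] := homeo_leb_open_ball oUn Ug.
  have n0 : 0 < n.+1%:R^-1 :> R by rewrite invr_gt0.
  have [r2 r20 r2P] := inverse_close g n0.
  pose r := Num.min (Num.min r1 r2) (Num.min (n.+1%:R^-1) (p.2 - unif_dist p.1 g)) / 2.
  have m0 : 0 < Num.min (Num.min r1 r2) (Num.min (n.+1%:R^-1) (p.2 - unif_dist p.1 g)).
    by rewrite !lt_min r10 r20 n0 subr_gt0.
  have [h1 h2 h3 h4] : [/\ r < r1, r < r2, r < n.+1%:R^-1 & r < p.2 - unif_dist p.1 g].
    have : r < Num.min (Num.min r1 r2) (Num.min (n.+1%:R^-1) (p.2 - unif_dist p.1 g)).
      by rewrite /r; lra.
    by rewrite !lt_min => /andP[/andP[-> ->] /andP[-> ->]].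
  have r_gt0 : 0 < r by rewrite divr_gt0.
  exists (g, r) => _ /=; split; last by lra.
  split => //; first exact: ltW.
    by move=> h gh; apply: r1P; exact: le_lt_trans h1.
  by move=> h x y gh; apply: r2P; exact: le_lt_trans h2.
have /choice[next nextP] (np : nat * (homeo_leb R * R)) : exists q : homeo_leb R * R,
    0 < np.2.2 -> good np.1 q.1 q.2 /\ unif_dist np.2.1 q.1 + q.2 < np.2.2.
  exact: step.
pose s := fix s n := if n is n'.+1 then next (n', s n') else (f0, r0).
have s_gt0 n : 0 < (s n).2.
  by elim: n => [//|n IH] /=; case: (nextP (n, s n) IH) => -[].
have sgood n : good n (s n.+1).1 (s n.+1).2 by case: (nextP (n, s n) (s_gt0 n)).
have snest n : unif_dist (s n).1 (s n.+1).1 + (s n.+1).2 < (s n).2.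
  by case: (nextP (n, s n) (s_gt0 n)).
have sball n m : (n <= m)%N -> unif_dist (s n).1 (s m).1 + (s m).2 <= (s n).2.
  elim: m => [|m IH]; first by rewrite leqn0 => /eqP ->; rewrite udxx add0r.
  rewrite leq_eqVlt => /orP[/eqP ->|/IH]; first by rewrite udxx add0r.
  have := udT (s m).1 (s n).1 (s m.+1).1; have := snest m; lra.
have sdist n m : (n <= m)%N -> unif_dist (s n).1 (s m).1 <= (s n).2.
  by move=> /sball; have := s_gt0 m; lra.
have sdist_lt n m : (n < m)%N -> unif_dist (s n).1 (s m).1 < (s n).2.
  by move=> /ltnW /sball; have := s_gt0 m; lra.
have /choice[f fP] x : exists y, forall n, tdist ((s n).1 x) y <= (s n).2.
  apply: torus_complete => n m nm.
  exact: le_trans (unif_dist_tdist _ _ x) (sdist n m nm).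
pose eps (n : nat) : R := n.+1%:R^-1.
have eps_small (e : R) : 0 < e -> exists n, eps n < e.
  move=> e0; exists (Num.truncn e^-1).
  by rewrite /eps invf_plt ?posrE// truncnS_gt.
have /choice[inv invP] n : exists g : torus R -> torus R,
    [/\ continuous g, cancel (s n).1 g & cancel g (s n).1].
  by case: (homeo_lebE (s n).1).
have /choice[g gP] x : exists y, forall n, tdist (inv n.+1 x) y <= eps n.
  apply: torus_complete => n m nm; have [_ _ H] := invP n.+1; have [_ _ H'] := invP m.+1.
  have [_ _ _ sg] := sgood n.
  (* Both inverse images are sent to [x] by two nearby maps, the situation covered by the last
     clause of [good]. *)
  by apply/ltW/(sg (s m.+1).1); [exact: sdist|rewrite H H'].
have cf_at (x : torus R) (e : R) : 0 < e ->
    exists2 d, 0 < d & forall y, tdist x y < d -> tdist (f x) (f y) < e.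
  move=> e0.
  have e3 : 0 < e / 3 by rewrite divr_gt0.
  have [n ne] := eps_small _ e3; have [_ sn _ _] := sgood n.
  have /torus_cvgP/(_ _ e3)[d d0 dP] := @homeo_leb_cont R (s n.+1).1 x.
  exists d => // y /dP; have := fP x n.+1; have := fP y n.+1.
  have := tdist_trans ((s n.+1).1 x) (f x) (f y).
  have := tdist_trans ((s n.+1).1 y) ((s n.+1).1 x) (f y).
  rewrite (tdist_sym (f x) ((s n.+1).1 x)); have := le_lt_trans sn ne; lra.
have cf : continuous f by move=> x; apply/torus_cvgP => e; exact: cf_at.
have cg_at (x : torus R) (e : R) : 0 < e ->
    exists2 d, 0 < d & forall y, tdist x y < d -> tdist (g x) (g y) < e.
  move=> e0.
  have e3 : 0 < e / 3 by rewrite divr_gt0.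
  have [n ne] := eps_small _ e3; have [ci _ _] := invP n.+1.
  have /torus_cvgP/(_ _ e3)[d d0 dP] := ci x.
  exists d => // y /dP; have := gP x n; have := gP y n.
  have := tdist_trans (inv n.+1 x) (g x) (g y).
  have := tdist_trans (inv n.+1 y) (inv n.+1 x) (g y).
  rewrite (tdist_sym (g x) (inv n.+1 x)); lra.
have cg : continuous g by move=> x; apply/torus_cvgP => e; exact: cg_at.
have eq_small x y : (forall e : R, 0 < e -> tdist x y <= e) -> x = y.
  move=> H; apply/tdist0_eq/eqP; rewrite eq_le tdist_ge0 andbT.
  by apply/ler_addgt0Pl => e e0; rewrite addr0 H.
have gf : cancel g f.
  move=> y; apply: eq_small => e e0.
  have e2 : 0 < e / 2 by rewrite divr_gt0.
  have /torus_cvgP/(_ _ e2)[d d0 dP] := cf (g y).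
  have [n ne] := eps_small (Num.min d (e / 2)) ltac:(by rewrite lt_min d0).
  move: ne; rewrite lt_min => /andP[nd ne].
  have [_ sn _ _] := sgood n; have [_ _ H] := invP n.+1.
  have gy_near : tdist (g y) (inv n.+1 y) < d.
    by rewrite tdist_sym; exact: le_lt_trans (gP y n) nd.
  have := dP _ gy_near.
  have := fP (inv n.+1 y) n.+1; rewrite H (tdist_sym y).
  have := tdist_trans (f (inv n.+1 y)) (f (g y)) y.
  by have := le_lt_trans sn ne; lra.
have fg : cancel f g.
  move=> y; apply: eq_small => e e0.
  have e2 : 0 < e / 2 by rewrite divr_gt0.
  have /torus_cvgP/(_ _ e2)[d d0 dP] := cg (f y).
  have [n ne] := eps_small (Num.min d (e / 2)) ltac:(by rewrite lt_min d0).
  move: ne; rewrite lt_min => /andP[nd ne].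
  have [_ sn _ _] := sgood n; have [_ H _] := invP n.+1.
  have fy_near : tdist (f y) ((s n.+1).1 y) < d.
    by rewrite tdist_sym; apply: le_lt_trans nd; exact: le_trans (fP y n.+1) sn.
  have := dP _ fy_near.
  have := gP ((s n.+1).1 y) n; rewrite H (tdist_sym y).
  have := tdist_trans (g ((s n.+1).1 y)) (g (f y)) y.
  by lra.
have close_f n x : tdist ((s n.+1).1 x) (f x) <= eps n.
  by have [_ sn _ _] := sgood n; exact: le_trans (fP x n.+1) sn.
(* A single approximant within 1/4 of the limit provides it with an equivariant lift. *)
have hom : homotopic_id f.
  have [n n4] := eps_small (1 / 4) ltac:(lra).
  have [_ _ hi _] := homeo_lebE (s n.+1).1.
  have [F0 F0P eF0] := homotopic_id_lift hi.
  have [|F [fF _ eF]] := nearby_lift F0P cf (lexx _).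
    by move=> x; exact: le_lt_trans (close_f n x) n4.
  exact: equivariant_homotopic fF (eF eF0).
have pf : preserves_leb f.
  apply: (preserves_leb_limit cf cg fg gf) => e e0.
  have [n ne] := eps_small e e0; have [ci H H'] := invP n.+1.
  exists (s n.+1).1, (inv n.+1); split.
  - exact: homeo_leb_cont.
  - exact: ci.
  - exact: H.
  - by case: (homeo_lebE (s n.+1).1).
  - move=> x; split; first exact: le_lt_trans (close_f n x) ne.
    exact: le_lt_trans (gP x n) ne.
have hf : homeomorphism f by split => //; exists g.
pose h := HomeoLeb (And3 hf hom pf).
have hP n : unif_dist (s n).1 h <= (s n).2.
  by apply: unif_dist_le => x; exact: fP.
exists h; split.
  apply: r0P; have := udT (s 1%N).1 f0 h; have := hP 1%N; have := snest 0%N.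
  by rewrite /=; lra.
by move=> n _; have [_ _ Un _] := sgood n; apply: Un; exact: hP.
Qed.

End completeness.

(** * Generic homeomorphisms *)

Section genericity.
Context {R : realType}.
Implicit Types (u v w k : plane R) (F G H : plane R -> plane R).
Implicit Types f g h : homeo_leb R.

(* [generic S] is open and dense whatever [S] is; on it, being adherent to the
   interior of [S] implies belonging to [S]. *)
Definition generic (T : topologicalType) (S : set T) := S° `|` ~` closure S°.

Lemma generic_open (T : topologicalType) (S : set T) : open (generic S).
Proof.
apply: openU; first exact: open_interior.
by apply: closed_openC; exact: closed_closure.
Qed.

Lemma generic_dense (T : topologicalType) (S : set T) : dense (generic S).
Proof.
move=> O [x Ox] oO; have [[y [Oy Sy]]|OS] := pselect (O `&` S° !=set0).
  by exists y; split => //; left.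
exists x; split => //; right => /(_ O); apply: contra_not OS => -[].
  exact: open_nbhs_nbhs.
by move=> y [Sy Oy]; exists y.
Qed.

Lemma generic_closure (T : topologicalType) (S : set T) x :
  generic S x -> closure S° x -> S x.
Proof. by case=> // Sx _; exact: interior_subset. Qed.

Lemma homeo_leb_closure_interior (S : set (homeo_leb R)) f :
  (forall r : R, 0 < r -> exists g (d : R), [/\ unif_dist f g < r, 0 < d &
    forall h, unif_dist g h < d -> S h]) -> closure S° f.
Proof.
move=> fS B /metric_nbhsP[r r0 rB]; have [g [d [fg d0 gS]]] := fS r r0.
exists g; split; last exact: rB.
by apply/metric_nbhsP; exists d.
Qed.

Lemma unif_dist_lift f g F G (r : R) : is_lift f F -> is_lift g G ->
  (forall u, edist (G u) (F u) <= r) -> unif_dist f g <= r.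
Proof.
move=> fF gG FG; apply: unif_dist_le => x; have [u <-] := torus_pi_surj x.
rewrite -(is_liftE _ fF) -(is_liftE _ gG) (le_trans (tdist_le _ _))// edistC.
exact: FG.
Qed.

Lemma homeo_leb_nearby_lift g h G (d : R) : is_lift g G ->
  unif_dist g h < d -> d <= 1 / 4 ->
  exists2 H, is_lift h H & forall u, edist (G u) (H u) < d.
Proof.
move=> gG gh d4; have [|H [hH GH _]] := nearby_lift gG (@homeo_leb_cont R h) d4.
  by move=> x; exact: le_lt_trans (unif_dist_tdist g h x) gh.
by exists H.
Qed.

Definition rat_vec (q : rat * rat) : plane R := (ratr q.1, ratr q.2).

Lemma rat_vec_near u (e : R) : 0 < e -> exists q, edist u (rat_vec q) < e.
Proof.
move=> e0; have near (r : R) : exists q : rat, `|r - ratr q| < e / 2.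
  have [|q] := @rat_in_itvoo R (r - e / 2) (r + e / 2); first lra.
  rewrite in_itv/= => /andP[? ?]; exists q.
  by rewrite ltr_norml; apply/andP; split; lra.
have [[q1 h1] [q2 h2]] := (near u.1, near u.2); exists (q1, q2).
by rewrite (le_lt_trans (edist_le _ _))//= [ltRHS]splitr ltrD.
Qed.

(* Pinning down the image of the origin selects one of the lifts, in a way that
   is stable under small perturbations. *)
Lemma pinned_lift_unique f F G q : is_lift f F -> is_lift f G ->
  edist (F 0) (rat_vec q) < 1 / 4 -> edist (G 0) (rat_vec q) < 1 / 4 -> F = G.
Proof.
move=> fF fG Fq Gq; have [k ik FG] := lifts_differ fF fG.
have FG0 : F 0 = G 0.
  apply: lift_unique; first by rewrite FG torus_piD.
  have := edist_triangle (rat_vec q) (F 0) (G 0).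
  by rewrite (edistC (rat_vec q)); lra.
have k0 : k = 0 by apply: (addrI (G 0)); rewrite addr0 -FG FG0.
by apply/funext => u; rewrite FG k0 addr0.
Qed.

(** Turns a property that holds robustly after arbitrarily small perturbations of [F] into a
    property of [F] itself: [f] is adherent to the interior of the condition, hence satisfies it for
    some lift, and the pin [q] identifies that lift with [F]. *)
Lemma generic_lift (X : (torus R -> torus R) -> (plane R -> plane R) -> Prop)
    f F q :
  is_lift f F -> edist (F 0) (rat_vec q) < 1 / 16 ->
  generic [set h : homeo_leb R | exists H, [/\ is_lift h H,
    edist (H 0) (rat_vec q) < 1 / 4 & X h H]] f ->
  (forall e : R, 0 < e -> exists g G (d : R), [/\ is_lift g G,
    forall u, edist (G u) (F u) <= e, 0 < d &
    forall h H, is_lift h H -> (forall u, edist (G u) (H u) <= d) -> X h H]) ->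
  X f F.
Proof.
move=> fF Fq fgen XP; have := generic_closure fgen; case=> [|G [fG Gq XG]].
  apply: homeo_leb_closure_interior => r r0.
  (* Going from [q] to [F 0], [G 0] and [H 0] takes three steps of at most 1/16, so [H] still
     satisfies the pinning bound 1/4. *)
  have e0 : 0 < Num.min (r / 2) (1 / 16) by rewrite lt_min divr_gt0//=; lra.
  have [g [G [d [gG GF d0 dP]]]] := XP _ e0.
  exists g, (Num.min d (1 / 16)); split.
  - apply: le_lt_trans (unif_dist_lift fF gG GF) _.
    by rewrite gt_min; apply/orP; left; lra.
  - by rewrite lt_min d0; lra.
  move=> h gh; have [|H hH GH] := homeo_leb_nearby_lift gG gh.
    by rewrite ge_min; apply/orP; right; lra.
  exists H; split => //; last first.
    by apply: dP => // u; rewrite ltW// (lt_le_trans (GH u))// ge_min lexx.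
  have : edist (G 0) (H 0) < 1 / 16.
    by rewrite (lt_le_trans (GH 0))// ge_min lexx orbT.
  have : edist (G 0) (F 0) <= 1 / 16.
    by rewrite (le_trans (GF 0))// ge_min lexx orbT.
  have := edist_triangle (G 0) (H 0) (rat_vec q).
  have := edist_triangle (F 0) (G 0) (rat_vec q).
  rewrite (edistC (H 0) (G 0)); lra.
by rewrite (pinned_lift_unique fF fG _ Gq)//; lra.
Qed.

End genericity.

(** * The countable family of generic conditions *)

Section generic_rotation.
Context {R : realType}.
Variables (P : nat -> torus R -> torus R) (Q : nat -> plane R -> plane R).
Hypothesis hP : forall N, (0 < N)%N -> grid_projection N (P N).
Hypothesis hQ : forall N, (0 < N)%N -> lattice_projection N (P N) (Q N).
Implicit Types (u v w k : plane R) (F G H : plane R -> plane R).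
Implicit Types f g h : homeo_leb R.

(** A single [n] gives both the least level of discretization and the precision. *)
Definition realizes (A : seq (rat * rat)) (n : nat) (h : torus R -> torus R)
    H :=
  exists N, [/\ (n <= N)%N, (0 < N)%N &
    rotation_near P Q h H N (map rat_vec A) n.+1%:R^-1].

(** The target vector is passed as the head of a list, so that both kinds of condition share one
    countable index type. *)
Definition long_orbit (A : seq (rat * rat)) (n : nat) (h : torus R -> torus R)
    H :=
  exists m u, [/\ (n <= m)%N, (0 < m)%N &
    edist (m%:R^-1 *: (iter m H u - u)) (rat_vec (head (0, 0) A)) < n.+1%:R^-1].

Definition condition (t : bool * (rat * rat) * seq (rat * rat) * nat) :
    set (homeo_leb R) :=
  let: (b, q, A, n) := t in
  [set h | exists H, [/\ is_lift h H, edist (H 0) (rat_vec q) < 1 / 4 &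
    (if b then realizes else long_orbit) A n h H]].

Definition generic_homeo : set (homeo_leb R) :=
  \bigcap_i if unpickle i is Some t then generic (condition t) else setT.

Lemma generic_homeo_open_dense i :
  let U : set (homeo_leb R) :=
    if unpickle i is Some t then generic (condition t) else setT in
  open U /\ dense U.
Proof.
case: unpickle => [t|]; split.
- exact: generic_open.
- exact: generic_dense.
- exact: openT.
- by move=> O O0 _; rewrite setIT.
Qed.

Lemma generic_homeo_condition f t : generic_homeo f -> generic (condition t) f.
Proof. by move=> /(_ (pickle t) I); rewrite pickleK. Qed.

Lemma small_index (e : R) (n : nat) : 0 < e ->
  exists2 l, (n <= l)%N & l.+1%:R^-1 < e.
Proof.
move=> e0; exists (maxn n (Num.truncn e^-1)); first exact: leq_maxl.
rewrite invf_plt ?posrE// (lt_le_trans (truncnS_gt _))// ler_nat ltnS.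
exact: leq_maxr.
Qed.

(** [perturb_rotation_set] supplies the perturbations asked for by [generic_lift]; the vectors of
    [A] are first replaced by rational ones, since the conditions have rational data. *)
Lemma generic_realizes f F (A : seq (plane R)) (e : R) (n : nat) :
  generic_homeo f -> is_lift f F -> A != [::] ->
  (forall a, a \in A -> rotation_set F a) -> 0 < e ->
  exists N, [/\ (n <= N)%N, (0 < N)%N & rotation_near P Q f F N A e].
Proof.
move=> fG fF A0 AF e0; have e20 : 0 < e / 2 by rewrite divr_gt0.
have [l nl le] := small_index n e20.
have l0 : 0 < l.+1%:R^-1 :> R by rewrite invr_gt0.
set r : R := l.+1%:R^-1 in le l0.
have r20 : 0 < r / 2 by rewrite divr_gt0.
have /choice[rA rAP] a := rat_vec_near a r20.
have p16 : 0 < 1 / 16 :> R by lra.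
have [q Fq] := rat_vec_near (F 0) p16.
have := @generic_homeo_condition f (true, q, map rA A, l) fG.
move=> /(generic_lift fF Fq) /= [|N [lN N0 [N1 N2]]].
  move=> e' e'0; have m0 : 0 < Num.min e' (r / 2) by rewrite lt_min e'0.
  have [N [g [G [d [[lN N0] gG GF d0 dP]]]]] :=
    perturb_rotation_set hP hQ l fF A0 AF m0.
  exists g, G, d; split => // [u|h H hH GH].
    by rewrite (le_trans (GF u))// ge_min lexx.
  exists N; split => //; have [d1 d2] := dP h H hH GH.
  split=> [v /d1[a aA va]|_ /mapP[_ /mapP[a aA ->] ->]].
    exists (rat_vec (rA a)); first by rewrite !map_f.
    move: va; rewrite lt_min => /andP[_ va].
    by have := edist_triangle a v (rat_vec (rA a)); have := rAP a; rewrite -/r; lra.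
  have [v Nv] := d2 a aA; rewrite lt_min => /andP[_ va]; exists v => //.
  by have := edist_triangle a v (rat_vec (rA a)); have := rAP a; rewrite -/r; lra.
exists N; split => //; first exact: leq_trans lN.
split=> [v /N1[_ /mapP[_ /mapP[a aA ->] ->] va]|a aA].
  exists a => //; have := edist_triangle (rat_vec (rA a)) v a.
  by have := rAP a; rewrite edistC; move: va; rewrite -/r; lra.
have [|v Nv va] := N2 (rat_vec (rA a)); first by rewrite !map_f.
exists v => //; have := edist_triangle (rat_vec (rA a)) v a.
by have := rAP a; rewrite edistC; move: va; rewrite -/r; lra.
Qed.

(** Vectors of discretizations close to [v] give, through [perturb_orbit], robust long orbits of
    perturbations with average displacement close to [v]; genericity then provides such orbits for
    [F]. *)
Lemma asymptotic_sub f F : generic_homeo f -> is_lift f F ->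
  asymptotic_rotation_set P Q f F `<=` rotation_set F.
Proof.
move=> fG fF v vF; apply/rotation_setP => M e e0.
have e20 : 0 < e / 2 by rewrite divr_gt0.
have [l Ml le] := small_index M e20.
have l0 : 0 < l.+1%:R^-1 :> R by rewrite invr_gt0.
set r : R := l.+1%:R^-1 in le l0.
have r30 : 0 < r / 3 by rewrite divr_gt0.
have [v' vv'] := rat_vec_near v r30.
have p16 : 0 < 1 / 16 :> R by lra.
have [q Fq] := rat_vec_near (F 0) p16.
have := @generic_homeo_condition f (false, q, [:: v'], l) fG.
move=> /(generic_lift fF Fq) /= [|m [u [lm m0 muv]]].
  move=> e' e'0; have c0 : 0 < Num.min e' (r / 3) by rewrite lt_min e'0.
  have [N0 N0P] := perturb_orbit hQ fF c0.
  have [|w [[N /= NN Nw] vw]] := vF N0.+1 isT [set w | edist v w < r / 3].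
    by apply/plane_nbhsP; exists (r / 3).
  have [g [G [d [gG GF d0 dP]]]] := N0P N l w (ltnW NN) Nw.
  exists g, G, d; split => // [u|h H hH GH].
    by rewrite (le_trans (GF u))// ge_min lexx.
  have [m [u [lm m0 muw]]] := dP H GH.
  exists m, u; split => //=.
  move: muw; rewrite lt_min => /andP[_ muw]; move: vw; rewrite /= => vw.
  have := edist_triangle w (m%:R^-1 *: (iter m H u - u)) (rat_vec v').
  have := edist_triangle v w (rat_vec v'); rewrite (edistC w v) -/r; lra.
exists m, u; split => //; first exact: leq_trans lm.
have := edist_triangle (rat_vec v') (m%:R^-1 *: (iter m F u - u)) v.
by move: muv; rewrite -/r (edistC (rat_vec v')) => /= muv; lra.
Qed.

End generic_rotation.

(** * Hausdorff distance and finite nets *)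

Section hausdorff.
Context {R : realType}.
Implicit Types (A B K : set (plane R)).

Lemma hausdorff_dist_le A B (e : R) :
  (forall a, A a -> exists2 b, B b & edist a b <= e) ->
  (forall b, B b -> exists2 a, A a & edist a b <= e) ->
  (hausdorff_dist A B <= e%:E)%E.
Proof.
move=> AB BA; rewrite /hausdorff_dist ge_max; apply/andP; split.
  apply: ge_ereal_sup => _ [a /AB[b Bb ab] <-].
  by apply: ereal_inf_le; exists (edist a b)%:E; [exists b|rewrite lee_fin].
apply: ge_ereal_sup => _ [b /BA[a Aa ab] <-].
by apply: ereal_inf_le; exists (edist a b)%:E; [exists a|rewrite lee_fin].
Qed.

Lemma hausdorff_dist_ge0 A B : B !=set0 -> (0 <= hausdorff_dist A B)%E.
Proof.
move=> [b Bb]; rewrite /hausdorff_dist le_max; apply/orP; right.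
apply: (@le_trans _ _ (ereal_inf [set (edist a b)%:E | a in A])).
  by apply: le_ereal_inf_tmp => _ [a _ <-]; rewrite lee_fin edist_ge0.
by apply: ereal_sup_ubound; exists b.
Qed.

(** The near-covering form of compactness is applied to the filter of finite lists of points of [K],
    directed by inclusion: near each [x], every list containing [x] is good. *)
Lemma compact_net K (e : R) : compact K -> 0 < e -> exists A : seq (plane R),
  (forall a, a \in A -> K a) /\
  forall x, K x -> exists2 a, a \in A & edist x a < e.
Proof.
move=> /compact_near_coveringP/near_covering_withinP cK e0.
pose lists := [set A : seq (plane R) | forall a, a \in A -> K a].
pose above (A : seq (plane R)) := [set B | lists B /\ {subset A <= B}].
pose covers (A : seq (plane R)) (x : plane R) := exists2 a, a \in A & edist x a < e.
have Ff : Filter (filter_from lists above).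
  apply: filter_from_filter; first by exists [::].
  move=> A B LA LB; exists (A ++ B).
    by move=> a; rewrite mem_cat => /orP[/LA|/LB].
  move=> C [LC ABC]; split; split => // a aA; apply: ABC.
    by rewrite mem_cat aA.
  by rewrite mem_cat aA orbT.
have [|A LA AP] := cK _ (filter_from lists above) covers Ff.
  move=> x Kx; exists ([set y | edist x y < e], above [:: x]).
    split; first by apply/plane_nbhsP; exists e.
    by exists [:: x] => // a; rewrite inE => /eqP ->.
  move=> [y B] [/= xy [_ xB]] _; exists x; last by rewrite edistC.
  by apply: xB; rewrite inE.
by exists A; split => // x Kx; exact: (AP A (conj LA (fun _ => id))).
Qed.

End hausdorff.

Theorem corollary24 (R : realType)
    (P : nat -> torus R -> torus R) (Q : nat -> R * R -> R * R)
    (hP : forall N, (0 < N)%N -> grid_projection N (P N))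
    (hQ : forall N, (0 < N)%N -> lattice_projection N (P N) (Q N)) :
  exists G : set (homeo_leb R),
    [/\ Gdelta G, dense G
      & forall f : homeo_leb R, G f ->
        forall F : R * R -> R * R, is_lift f F ->
          (forall K : set (R * R), K !=set0 -> compact K ->
             K `<=` rotation_set F ->
             exists N : nat -> nat,
               [/\ forall i, (0 < N i)%N,
                   forall i j, (i < j)%N -> (N i < N j)%N
                 & hausdorff_dist (discrete_rotation_set P Q f F (N i)) K
                     @[i --> \oo] --> 0%E])
          /\ asymptotic_rotation_set P Q f F = rotation_set F].
Proof.
exists (generic_homeo P Q); split.
- eexists; last by [].
  by move=> i; case: (generic_homeo_open_dense P Q i).
- by apply: homeo_leb_Baire => i; exact: generic_homeo_open_dense.
move=> f fG F fF; split; last first.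
  apply/seteqP; split; first exact: asymptotic_sub.
  move=> v Fv M /= M0 B /plane_nbhsP[e e0 eB].
  have [|N [MN N0 [_ /(_ v)]]] :=
    generic_realizes hP hQ (A := [:: v]) M fG fF isT _ e0.
    by move=> a; rewrite inE => /eqP ->.
  rewrite inE eqxx => /(_ isT)[w Nw wv]; exists w; split; first by exists N.
  by apply: eB; rewrite edistC.
move=> K K0 cK KF.
(* The pair holds the index fixing the precision and the preceding level, so that the recursion
   yields strictly increasing levels. *)
have step (il : nat * nat) : exists N, [/\ (il.2 < N)%N, (0 < N)%N &
    (hausdorff_dist (discrete_rotation_set P Q f F N) K <= (il.1.+1%:R^-1)%:E)%E].
  case: il => i l /=; set r : R := i.+1%:R^-1.
  have r20 : 0 < r / 2 by rewrite divr_gt0// invr_gt0.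
  have [A [AK KA]] := compact_net cK r20.
  have A0 : A != [::].
    by have [x /KA[a]] := K0; case: (A).
  have [N [lN N0 [N1 N2]]] := generic_realizes hP hQ l.+1 fG fF A0
    (fun a aA => KF _ (AK a aA)) r20.
  exists N; split => //; apply: hausdorff_dist_le => [v /N1[a aA va]|x /KA[a aA xa]].
    by exists a; [exact: AK|lra].
  have [v Nv va] := N2 a aA; exists v => //.
  by have := edist_triangle a v x; rewrite (edistC a x); lra.
have /choice[next nextP] := step.
pose N := fix N i := next (i, if i is j.+1 then N j else 0%N).
have NE i : N i = next (i, if i is j.+1 then N j else 0%N) by case: i.
exists N; split.
- by move=> i; rewrite NE; case: (nextP (i, if i is j.+1 then N j else 0%N)).
- have Nlt i : (N i < N i.+1)%N by rewrite (NE i.+1); case: (nextP (i.+1, N i)).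
  move=> i; elim=> [//|j IH]; rewrite ltnS leq_eqVlt => /orP[/eqP -> //|/IH ij].
  exact: ltn_trans (Nlt j).
apply: (@squeeze_cvge _ _ _ _ (cst 0%E) _ (fun i => (i.+1%:R^-1)%:E)).
- apply: nearW => i; rewrite hausdorff_dist_ge0//= NE.
  by case: (nextP (i, if i is j.+1 then N j else 0%N)).
- exact: cvg_cst.
- by apply: cvg_EFin; [exact: nearW|exact: cvg_harmonic].
Qed.
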